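(* Let $0<\alpha<1$, $\beta>0$, $\alpha+1/\beta\ge 1$. Suppose that $M(0,1)$ is the Marcinkiewicz endpoint space with fundamental function $\varphi$. Then the fundamental function $\varphi_X$ of the largest r.i. space $X(0,1)$ having the property $$H_\alpha^\beta\colon X(0,1)\to M(0,1)$$ satisfies $$\varphi_X(t)\simeq t\sup_{t<s<1}\varphi(s^{1/\beta})\,s^{\alpha-1},\quad t\in(0,1),$$ that is, each side is bounded by a positive constant multiple of the other, with constants independent of $t\in(0,1)$.
   Context: All spaces are over $I=(0,1)$ with Lebesgue measure. $\mathcal M(I)$ is the class of real-valued measurable functions on $I$, $\mathcal M^+(I)$ its nonnegative members. For $f\in\mathcal M(I)$, $f^*(t)=\inf\{\lambda>0:\ |\{x\in I: |f(x)|>\lambda\}|\le t\}$ is the nonincreasing rearrangement and $f^{**}(t)=\frac1t\int_0^t f^*(s)\,ds$. Operator: $(H_\alpha^\beta f)(t)=\int_{t^\beta}^1 f(s)\,s^{\alpha-1}\,ds$, $t\in(0,1)$. R.i. spaces: a rearrangement-invariant (r.i.) Banach function norm is a map $\rho\colon\mathcal M^+(I)\to[0,\infty]$ such that (P1) $\rho(f)=0$ iff $f=0$ a.e., $\rho(af)=a\rho(f)$ for $a\ge0$, $\rho(f+g)\le\rho(f)+\rho(g)$; (P2) $0\le f\le g$ a.e. implies $\rho(f)\le\rho(g)$; (P3) $0\le f_n\uparrow f$ a.e. implies $\rho(f_n)\uparrow\rho(f)$; (P4) $\rho(\chi_I)<\infty$; (P5) $\int_0^1 f\le C\rho(f)$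 for a constant $C$ independent of $f$; (P6) $\rho(f)=\rho(f^* )$. The corresponding r.i. space is $\{f\in\mathcal M(I):\rho(|f|)<\infty\}$ with norm $\|f\|=\rho(|f|)$. Its fundamental function is $t\mapsto\rho(\chi_{(0,t)})$ for $t\in(0,1)$, with value $0$ at $t=0$. Marcinkiewicz endpoint space: for a concave fundamental function $\varphi$ (concave, nonnegative, nondecreasing, vanishing exactly at $0$, possibly discontinuous at $0$), $M_\varphi(0,1)$ is the r.i. space with norm $\sup_{0<t<1}f^{**}(t)\varphi(t)$; its fundamental function is $\varphi$. Boundedness: $T\colon X\to Y$ means that there is $C>0$ with $\|Tf\|_Y\le C\|f\|_X$ for every $f\in X$. Largest: the largest r.i. space with a given property is an r.i. space that has the property and contains every r.i. space having the property. Spaces are identified up to equivalence of norms. *)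

(* Defs.v *)
From HB Require Import structures.
From mathcomp Require Import all_boot all_order all_algebra.
From mathcomp Require Import all_classical all_reals all_analysis.

Set Implicit Arguments.
Unset Strict Implicit.
Unset Printing Implicit Defensive.
Import Order.TTheory GRing.Theory Num.Theory.
Import numFieldNormedType.Exports.
Local Open Scope classical_set_scope.
Local Open Scope ring_scope.

(* Functions on I = (0,1) are represented by functions R -> R, whose values
   outside I play no role. *)
Definition I01 (R : realType) : set R := `]0, 1[.
Arguments I01 {R}.

Local Notation leb := lebesgue_measure.

Definition mfunI (R : realType) : set (R -> R) :=
  [set f : R -> R | measurable_fun I01 f].

Definition mfunI_nneg (R : realType) : set (R -> R) :=
  [set f : R -> R | measurable_fun I01 f /\ forall x, I01 x -> 0 <= f x].

(* f^*; for 0 < t the set is nonempty and bounded below when f is measurable,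
   so that the real infimum is the actual one. *)
Definition rearr (R : realType) (f : R -> R) (t : R) : R :=
  inf [set l : R | 0 < l /\
        (leb [set x | (I01 x /\ l < `|f x|)%R] <= t%:E)%E].

(* f^**; it is +oo when f is not integrable. *)
Definition rearr_avg (R : realType) (f : R -> R) (t : R) : \bar R :=
  ((t^-1)%:E * \int[leb]_(s in `]0%R, t[) (rearr f s)%:E)%E.

(* Only the restriction of rho to mfunI_nneg matters. *)
Record ri_norm (R : realType) (rho : (R -> R) -> \bar R) : Prop := RiNorm {
  ri_ge0 : forall f, mfunI_nneg f -> (0 <= rho f)%E ;
  ri_eq0 : forall f, mfunI_nneg f ->
    (rho f = 0%E <-> {ae leb, forall x, I01 x -> f x = 0}) ;
  ri_homo : forall (a : R) f, 0 <= a -> mfunI_nneg f ->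
    rho (fun x => a * f x) = (a%:E * rho f)%E ;
  ri_add : forall f g, mfunI_nneg f -> mfunI_nneg g ->
    (rho (fun x => f x + g x)%R <= rho f + rho g)%E ;
  ri_mono : forall f g, mfunI_nneg f -> mfunI_nneg g ->
    {ae leb, forall x, I01 x -> f x <= g x} -> (rho f <= rho g)%E ;
  ri_fatou : forall (f_ : nat -> R -> R) f,
    (forall n, mfunI_nneg (f_ n)) -> mfunI_nneg f ->
    {ae leb, forall x, I01 x ->
      nondecreasing_seq (f_ ^~ x) /\ f_ n x @[n --> \oo] --> f x} ->
    nondecreasing_seq (rho \o f_) /\ rho (f_ n) @[n --> \oo] --> rho f ;
  ri_one : (rho (\1_I01) < +oo)%E ;
  ri_L1 : exists2 C : R, 0 < C & forall f, mfunI_nneg f ->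
    (\int[leb]_(x in I01) (f x)%:E <= C%:E * rho f)%E ;
  ri_rearr : forall f, mfunI_nneg f -> rho f = rho (rearr f)
}.

Definition ri_norm_of (R : realType) (rho : (R -> R) -> \bar R) (f : R -> R)
  : \bar R := rho (fun x => `|f x|).

Definition ri_space (R : realType) (rho : (R -> R) -> \bar R)
  : set (R -> R) :=
  [set f : R -> R | mfunI f /\ (ri_norm_of rho f < +oo)%E].

(* At t = 0 this is rho of the zero function, which is 0 for an r.i. norm. *)
Definition fund_fun (R : realType) (rho : (R -> R) -> \bar R) (t : R)
  : \bar R := rho (\1_(`]0, t[ : set R)).

(* phi is considered on [0,1[ ; as 0 belongs to the domain of concavity, a
   positive jump of phi at 0 is allowed. *)
Record concave_fund_fun (R : realType) (phi : R -> R) : Prop :=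
  ConcaveFundFun {
  cff_concave : convex_function (`[0, 1[%classic : set R) (fun t => - phi t) ;
  cff_ge0 : {in `[0, 1[, forall t, 0 <= phi t} ;
  cff_ndecr : {in `[0, 1[ &, {homo phi : s t / s <= t}} ;
  cff_eq0 : {in `[0, 1[, forall t, phi t = 0 <-> t = 0}
}.

Definition marcinkiewicz (R : realType) (phi : R -> R) (f : R -> R) : \bar R :=
  ereal_sup [set (rearr_avg f t * (phi t)%:E)%E | t in I01].

(* Real-valued integral: it is the genuine one for f integrable on I, hence
   on every r.i. space. *)
Definition hardy_op (R : realType) (alpha beta : R) (f : R -> R) (t : R) : R :=
  \int[leb]_(s in `]t `^ beta, 1[) (f s * s `^ (alpha - 1)).

(* The images are required to lie in the target space, so in particular to be
   measurable. *)
Definition bounded_op (R : realType) (T : (R -> R) -> (R -> R))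
    (rhoX rhoY : (R -> R) -> \bar R) : Prop :=
  exists2 C : R, 0 < C & forall f, ri_space rhoX f ->
    ri_space rhoY (T f) /\
    (ri_norm_of rhoY (T f) <= C%:E * ri_norm_of rhoX f)%E.

Definition largest_ri (R : realType) (P : ((R -> R) -> \bar R) -> Prop)
    (rhoX : (R -> R) -> \bar R) : Prop :=
  [/\ ri_norm rhoX, P rhoX &
      forall rhoZ, ri_norm rhoZ -> P rhoZ -> ri_space rhoZ `<=` ri_space rhoX].

Definition equiv_on (R : realType) (A : set R) (F G : R -> \bar R) : Prop :=
  exists c C : R, [/\ 0 < c, 0 < C &
    forall t, A t -> (F t <= C%:E * G t)%E /\ (G t <= c%:E * F t)%E].

(* Main.v *)
Require Import Defs.
From HB Require Import structures.
From mathcomp Require Import all_boot all_order all_algebra.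
From mathcomp Require Import all_classical all_reals all_analysis.
From mathcomp Require Import measurable_realfun ring lra.
Set Implicit Arguments.
Unset Strict Implicit.
Unset Printing Implicit Defensive.
Import Order.TTheory GRing.Theory Num.Theory.
Import numFieldNormedType.Exports.
Local Open Scope classical_set_scope.
Local Open Scope ring_scope.

(** Write [psi t] for the right-hand side of the equivalence.

    Lower bound for the fundamental function of [X]. For [t < s < 1] the indicator of
    [(s - t / 2, s)] has [X]-norm at most [fund_fun rhoX t], by rearrangement
    invariance, whereas its image under the operator is at least
    [t / 2 * s `^ (alpha - 1)] on [(0, (s / 2) `^ beta^-1)]. Its Marcinkiewicz norm is
    therefore at least a constant times [t * s `^ (alpha - 1) * phi (s `^ beta^-1)],
    and the boundedness of the operator on [X] gives [psi <= c * fund_fun rhoX]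
    ([fund_fun_ge]).

    Upper bound. Here the maximality of [X] is used: it is enough to exhibit one r.i.
    space [Z] on which the operator is bounded and whose fundamental function is at
    most a multiple of [psi]. Indeed [X] then contains [Z], and an inclusion between
    r.i. spaces is automatically continuous ([ri_embedding], a closed graph argument).

    To find [Z], let [f >= 0]. By Tonelli, the integral over [(0, t)] of the image of
    [f] is the integral of [f] against [s `^ (alpha - 1) * min (t, s `^ beta^-1)].
    The hypothesis [alpha + beta^-1 >= 1] is exactly what is needed to bound this
    kernel by [t * max (t `^ beta, s) `^ (alpha - 1)] ([hardy_kernel_le]), which is
    nonincreasing in [s]. This suggests, for the norm of [Z], the supremum over [t] of
    [phi t] times the integral of [f^*] against
    [max (t `^ beta, s) `^ (alpha - 1)]. Such a functional is subadditive because a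
    decreasing weight is a mixture of indicators of intervals [(0, x)], and because
    the integral of [f^*] over [(0, x)] is subadditive in [f]. Only dyadic values of
    [t `^ beta] and of [x] are needed up to constants, so that with
    [q = 2 `^ (1 - alpha)] the norm of [Z] is taken to be
      sup_n phi (2^-(n+1) `^ beta^-1) * sum_(k <= n) q ^ k * int_0^(2^-k) f^*
    ([dyadic_norm]). The integrals of [f^*] are handled through the distribution
    function of [f] ([head_integral]): the layer cake formula makes invariance and the
    Fatou property clear, and identifies the integral over [(0, x)] with the infimum
    over [c >= 0] of [c * x + int (f - c)_+], which makes subadditivity clear
    ([head_integral_le], [head_integral_ge]). Geometric sums then give the boundedness
    of the operator ([hardy_op_bounded_dyadic]) and the bound by [psi]
    ([dyadic_norm_fund_fun]). *)

Local Notation leb := lebesgue_measure.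

(** * Distribution functions *)

Section distribution.
Context {R : realType}.
Implicit Types (f g : R -> R) (l c x t : R).

Definition distf f l : \bar R := leb [set x | (I01 x /\ l < f x)%R].

Lemma measurable_I01 : measurable (@I01 R).
Proof. exact: measurable_itv. Qed.

Lemma measurable_superlevel f l : measurable_fun I01 f ->
  measurable [set x | (I01 x /\ l < f x)%R].
Proof.
move=> mf; rewrite (_ : [set x | _] = I01 `&` f @^-1` `]l, +oo[%classic).
  by apply: mf => //; exact: measurable_I01.
by apply/seteqP; split => x /=; rewrite in_itv/= andbT.
Qed.

Lemma leb_I01 : leb (@I01 R) = 1%E.
Proof. by rewrite lebesgue_measure_itv/= lte01 oppr0 adde0. Qed.

Lemma distf_ge0 f l : (0 <= distf f l)%E. Proof. exact: measure_ge0. Qed.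

Lemma distf_le1 f l : measurable_fun I01 f -> (distf f l <= 1)%E.
Proof.
move=> mf; rewrite -leb_I01; apply: le_measure; rewrite ?inE.
- exact: measurable_superlevel.
- exact: measurable_I01.
- by move=> x [].
Qed.

Lemma distf_fin_num f l : measurable_fun I01 f -> distf f l \is a fin_num.
Proof.
by move=> mf; rewrite ge0_fin_numE ?distf_ge0// (le_lt_trans (distf_le1 l mf))// ltry.
Qed.

Lemma distf_ni f l c : measurable_fun I01 f -> l <= c -> (distf f c <= distf f l)%E.
Proof.
move=> mf lc; apply: le_measure; rewrite ?inE; try exact: measurable_superlevel.
by move=> x [Ix cf]; split=> //; exact: le_lt_trans cf.
Qed.

Lemma distf_ae_le f g l : measurable_fun I01 f -> measurable_fun I01 g ->
  {ae leb, forall x, I01 x -> f x <= g x} -> (distf f l <= distf g l)%E.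
Proof.
move=> mf mg [N [mN N0 sub]].
rewrite -[leRHS]adde0 -N0.
apply: (@le_trans _ _ (leb ([set x | I01 x /\ l < g x] `|` N))).
  apply: le_measure; rewrite ?inE; first exact: measurable_superlevel.
    by apply: measurableU => //; exact: measurable_superlevel.
  move=> x /= [Ix lf]; have [Nx|Nx] := pselect (N x); [by right|left; split=> //].
  rewrite (lt_le_trans lf)//.
  by apply: contrapT => h; apply/Nx/sub => /= /(_ Ix).
by apply: measureU2 => //; exact: measurable_superlevel.
Qed.

Let patchI f : R -> R := f \_ I01.

Let mpatchI f : measurable_fun I01 f -> measurable_fun setT (patchI f).
Proof. by move=> mf; apply/(measurable_restrictT _ _).1 => //; exact: measurable_I01. Qed.

Let subgraph f c : set (R * R) := [set z | (I01 z.1 /\ c < z.2 /\ z.2 < f z.1)%R].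

Let measurable_subgraph f c : measurable_fun I01 f -> measurable (subgraph f c).
Proof.
move=> mf; have -> : subgraph f c = (fst @^-1` I01) `&`
    ((fun z : R * R => (c < z.2)%R) @^-1` [set true] `&`
     (fun z : R * R => (z.2 < patchI f z.1)%R) @^-1` [set true]).
  apply/seteqP; split => [[x l]|[x l]] /=.
    by move=> [Ix [cl lf]]; rewrite /patchI patchE mem_set.
  by move=> [Ix]; rewrite /patchI patchE mem_set// => -[].
have mT (h : R * R -> bool) : measurable_fun setT h -> measurable (h @^-1` [set true]).
  by move=> mh; rewrite -[X in measurable X]setTI; exact: mh.
apply: measurableI.
  by rewrite -[X in measurable X]setTI; apply: measurable_fst => //; exact: measurable_I01.
apply: measurableI; apply: mT; apply: measurable_fun_ltr => //.
by apply: measurableT_comp => //; exact: mpatchI.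
Qed.

Let integral_subgraph_x f c l : measurable_fun I01 f ->
  (\int[leb]_x (\1_(subgraph f c) (x, l))%:E = if (c < l)%R then distf f l else 0)%E.
Proof.
move=> mf; case: ifPn => cl.
  transitivity (\int[leb]_x (\1_[set x | (I01 x /\ l < f x)%R] x)%:E)%E; last first.
    by rewrite integral_indic ?setIT//; exact: measurable_superlevel.
  apply: eq_integral => x _; rewrite !indicE; congr ((nat_of_bool _)%:R%:E).
  by apply/idP/idP; rewrite !inE /subgraph/= => -[? ?]; tauto.
rewrite integral0_eq// => x _; rewrite indicE memNset//= => -[_ [+ _]].
by move/negP : cl.
Qed.

Lemma measurable_distf f : measurable_fun I01 f -> measurable_fun setT (distf f).
Proof.
move=> mf; have -> : distf f = EFin \o (fun l => fine (distf f l)).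
  by apply/funext => l /=; rewrite fineK// distf_fin_num.
apply/measurable_EFinP; apply: nonincreasing_measurable; first exact: measurableT.
move=> l c lc.
by rewrite fine_le ?distf_fin_num// distf_ni.
Qed.

(** The layer cake formula, truncated at height [c]: both sides are the area of
    the part of the subgraph of [f] above height [c]. *)
Lemma integral_distf f c : measurable_fun I01 f ->
  (\int[leb]_(l in `]c, +oo[) distf f l
   = \int[leb]_(x in I01) (Num.max 0 (f x - c))%:E)%E.
Proof.
move=> mf; rewrite integral_mkcond [RHS]integral_mkcond.
transitivity (\int[leb]_l \int[leb]_x (\1_(subgraph f c) (x, l))%:E)%E.
  apply: eq_integral => l _; rewrite integral_subgraph_x// patchE.
  by congr (if _ then _ else _); apply/idP/idP; rewrite inE/= in_itv/= andbT.
rewrite -(@fubini_tonelli _ _ _ _ _ leb leb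
    (fun z => (\1_(subgraph f c) z)%:E)) => [|//|z]; last 2 first.
- by apply/measurable_EFinP/measurable_indic; exact: measurable_subgraph.
- by rewrite lee_fin indicE.
apply: eq_integral => x _; rewrite patchE; case: ifPn; rewrite ?inE ?notin_setE => Ix.
  transitivity (leb (`]c, f x[ : set R)).
    transitivity (\int[leb]_l (\1_(`]c, f x[ : set R) l)%:E)%E; last first.
      by rewrite integral_indic ?setIT.
    apply: eq_integral => l _; rewrite !indicE; congr ((nat_of_bool _)%:R%:E).
    apply/idP/idP; rewrite !inE /subgraph/= in_itv/=.
      by move=> [_ [-> ->]].
    by move=> /andP[-> ->].
  rewrite lebesgue_measure_itv/= lte_fin; case: ltP => h.
    by rewrite -EFinB; congr (_%:E); rewrite max_r// subr_ge0 ltW.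
  by rewrite max_l// subr_le0.
by rewrite integral0_eq// => l _; rewrite indicE memNset//= => -[].
Qed.

(** Measurable functions are finite and [I01] has finite measure, so the
    distribution function vanishes at infinity. This is what makes the set in the
    definition of [rearr] nonempty, so that its infimum is the intended one. *)
Lemma distf_small f (e : R) : measurable_fun I01 f -> 0 < e ->
  exists2 l, 0 < l & (distf f l <= e%:E)%E.
Proof.
move=> mf e0; pose F n := [set x | (I01 x /\ n%:R < f x)%R].
have : leb (F n) @[n --> \oo] --> leb (\bigcap_n F n).
  apply: nonincreasing_cvg_mu.
  - by rewrite (le_lt_trans (distf_le1 0 mf))// ltry.
  - by move=> n; exact: measurable_superlevel.
  - by apply: bigcap_measurable => // n _; exact: measurable_superlevel.
  - move=> n m nm; apply/subsetPset => x /= [Ix fx]; split=> //.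
    by rewrite (le_lt_trans _ fx)// ler_nat.
have -> : \bigcap_n F n = set0.
  apply/seteqP; split => // x /= /(_ (Num.truncn (f x)).+1 Logic.I) [_].
  by rewrite ltNge ltW// truncnS_gt.
rewrite measure0 => /fine_cvgP[_ /cvgrPdist_lt /(_ _ e0)] [n _ H].
exists n.+1%:R => //; rewrite -[leLHS]fineK ?distf_fin_num// lee_fin ltW//.
have /= := H n.+1 (leqnSn n); rewrite sub0r normrN; apply: le_lt_trans.
exact: ler_norm.
Qed.

(** Right continuity of a nonincreasing function, in the only form needed to
    invert it: [distf f] stays above [t] a little to the right of [l]. *)
Lemma distf_right_open f l (t : \bar R) : measurable_fun I01 f -> (t < distf f l)%E ->
  exists2 c, l < c & (t < distf f c)%E.
Proof.
move=> mf tl; pose F n := [set x | (I01 x /\ l + n.+1%:R^-1 < f x)%R].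
have cF : leb (F n) @[n --> \oo] --> leb (\bigcup_n F n).
  apply: nondecreasing_cvg_mu.
  - by move=> n; exact: measurable_superlevel.
  - by apply: bigcup_measurable => n _; exact: measurable_superlevel.
  - move=> n m nm; apply/subsetPset => x /= [Ix fx]; split=> //.
    by rewrite (le_lt_trans _ fx)// lerD2l lef_pV2 ?posrE// ler_nat.
have UF : \bigcup_n F n = [set x | (I01 x /\ l < f x)%R].
  apply/seteqP; split => [x [n _ [Ix fx]]|x [Ix fx]].
    by split=> //; rewrite (lt_trans _ fx)// ltrDl.
  exists (Num.truncn (f x - l)^-1) => //; split => //.
  rewrite -ltrBrDl -[ltRHS]invrK ltf_pV2 ?posrE ?invr_gt0 ?subr_gt0//.
  exact: truncnS_gt.
rewrite UF in cF; apply: contrapT => h.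
have : (leb [set x | (I01 x /\ l < f x)%R] <= t)%E.
  move/cvg_lim : (cF) => <- //; apply: lime_le; first by apply/cvg_ex; eexists; exact: cF.
  apply: nearW => n; rewrite leNgt; apply/negP => tn; apply: h.
  by exists (l + n.+1%:R^-1) => //; rewrite ltrDl.
by rewrite leNgt tl.
Qed.

End distribution.

Local Notation absf f := (fun x => `|f x|%R).

(** * The decreasing rearrangement *)

Section rearrangement.
Context {R : realType}.
Implicit Types (f g : R -> R) (l c x s t : R).

Let lvl f t := [set l : R | 0 < l /\
        (leb [set x | (I01 x /\ l < `|f x|)%R] <= t%:E)%E].

Let mabs f : measurable_fun I01 f -> measurable_fun I01 (absf f).
Proof. by move=> mf; apply: measurableT_comp => //. Qed.

Let lvl_neq0 f t : measurable_fun I01 f -> 0 < t -> lvl f t !=set0.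
Proof.
move=> mf t0; have [l l0 lt] := distf_small (mabs mf) t0.
by exists l.
Qed.

Let lvl_lb f t : lbound (lvl f t) 0.
Proof. by move=> l [/ltW]. Qed.

Lemma rearr_ge0 f t : 0 <= rearr f t.
Proof.
have [h|h] := pselect (lvl f t !=set0); first by apply: (lb_le_inf h); exact: lvl_lb.
by rewrite /rearr -/(lvl f t); move/nonemptyPn : h => ->; rewrite inf0.
Qed.

(** The rearrangement is the right-continuous inverse of the distribution
    function; pointwise bounds on [rearr] go through this equivalence instead of the
    infimum. *)
Lemma rearr_gt f t l : measurable_fun I01 f -> 0 < t -> 0 <= l ->
  (l < rearr f t) = (t%:E < distf (absf f) l)%E.
Proof.
move=> mf t0 l0; apply/idP/idP => h; last first.
  have [c lc tc] := distf_right_open (mabs mf) h.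
  apply: (lt_le_trans lc); apply: lb_le_inf; first exact: lvl_neq0.
  move=> k [k0 kt]; rewrite leNgt; apply/negP => kc.
  have := le_trans (distf_ni (mabs mf) (ltW kc)) kt.
  by rewrite leNgt tc.
rewrite ltNge; apply/negP => lt.
have inf_le k : lvl f t k -> rearr f t <= k.
  by move=> ?; apply: ge_inf => //; exists 0; exact: lvl_lb.
have /inf_le : lvl f t ((l + rearr f t) / 2); last by move=> ?; lra.
by split; [lra|apply: (le_trans _ lt); apply: distf_ni; [exact: mabs|lra]].
Qed.

Lemma rearr_le f t l : measurable_fun I01 f -> 0 < t -> 0 <= l ->
  (rearr f t <= l) = (distf (absf f) l <= t%:E)%E.
Proof. by move=> mf t0 l0; rewrite leNgt rearr_gt// -leNgt. Qed.

Lemma superlevel_rearr f l : measurable_fun I01 f -> 0 <= l ->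
  [set x | (I01 x /\ l < rearr f x)%R]
  = `]0, fine (distf (absf f) l)[%classic.
Proof.
move=> mf l0; have d1 := distf_le1 l (mabs mf).
have := distf_fin_num l (mabs mf); move: d1 => /[swap] /fineK <-.
set d := fine _ => d1.
apply/seteqP; split => x /=; rewrite /I01/= !in_itv/=.
  move=> [/andP[x0 x1]]; rewrite rearr_gt//.
  rewrite -[X in (_ < X)%E](fineK (distf_fin_num l (mabs mf))) lte_fin.
  by rewrite x0 => ->.
move=> /andP[x0 xd]; split; first by rewrite x0 (lt_le_trans xd)// -lee_fin.
rewrite rearr_gt//.
by rewrite -[X in (_ < X)%E](fineK (distf_fin_num l (mabs mf))) lte_fin.
Qed.

(** Equimeasurability, immediate from [superlevel_rearr]: the superlevel sets of
    the rearrangement are initial intervals of the right length. *)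
Lemma distf_rearr f l : measurable_fun I01 f -> 0 <= l ->
  distf (rearr f) l = distf (absf f) l.
Proof.
move=> mf l0; rewrite {1}/distf superlevel_rearr// lebesgue_measure_itv/= lte_fin.
have := distf_ge0 (absf f) l.
rewrite -[X in (0 <= X)%E](fineK (distf_fin_num l (mabs mf))) lee_fin le_eqVlt.
case/orP => [/eqP d0|->].
  by rewrite -{1}d0 ltxx -[RHS](fineK (distf_fin_num l (mabs mf))) -d0.
by rewrite oppr0 adde0 fineK// distf_fin_num//; exact: mabs.
Qed.

Lemma measurable_rearr f : measurable_fun I01 f -> measurable_fun I01 (rearr f).
Proof.
move=> mf; apply: (measurability (@RGenOInfty.G R)) => [|/= _ [_] [l] -> <-].
  exact: RGenOInfty.measurableE.
have -> : I01 `&` rearr f @^-1` `]l, +oo[%classic = [set x | (I01 x /\ l < rearr f x)%R].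
  by apply/seteqP; split => x /=; rewrite in_itv/= andbT.
have [l0|l0] := leP 0 l; first by rewrite superlevel_rearr//; exact: measurable_itv.
rewrite (_ : [set x | _] = I01); first exact: measurable_I01.
apply/seteqP; split => x /=; first by case.
by move=> Ix; split=> //; rewrite (lt_le_trans l0)// rearr_ge0.
Qed.

End rearrangement.

(** * Integrals of the rearrangement over initial intervals *)

Lemma nondecreasing_cvg_mine (R : realType) (u : nat -> \bar R) (a l : \bar R) :
  nondecreasing_seq u -> u n @[n --> \oo] --> l ->
  mine a (u n) @[n --> \oo] --> mine a l.
Proof.
move=> nd_u u_l.
have u_le n : (u n <= l)%E.
  rewrite -(cvg_lim _ u_l)// (cvg_lim _ (ereal_nondecreasing_cvgn nd_u))//.
  by apply: ereal_sup_ubound; exists n.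
have -> : mine a l = ereal_sup (range (fun n => mine a (u n))).
  apply/le_anti/andP; split; last first.
    by apply: ge_ereal_sup => _ [n _ <-]; rewrite le_min !ge_min lexx/= u_le orbT.
  rewrite leNgt; apply/negP; set S := ereal_sup _.
  rewrite lt_min => /andP[Sa Sl].
  have /lt_eqF : (S < S)%E; last by rewrite eqxx.
  have [n Sn] : exists n, (S < u n)%E.
    apply: contrapT => h; move: Sl; rewrite ltNge => /negP; apply.
    rewrite -(cvg_lim _ u_l)//; apply: lime_le; first by apply/cvg_ex; eexists; exact: u_l.
    by apply: nearW => n; rewrite leNgt; apply/negP => Sn; apply: h; exists n.
  apply: (@lt_le_trans _ _ (mine a (u n))); first by rewrite lt_min Sa Sn.
  by apply: ereal_sup_ubound; exists n.
apply: ereal_nondecreasing_cvgn => n m nm.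
by rewrite le_min !ge_min lexx/= nd_u ?orbT.
Qed.

Section almost_everywhere.
Context {R : realType}.
Implicit Types (f : R -> R).

Lemma ae_all (P : R -> Prop) : (forall x, P x) -> {ae leb, forall x : R, P x}.
Proof.
move=> AP; exists set0; split => //.
by move=> x /=; apply.
Qed.

Lemma ae_nondecreasing_le (f_ : nat -> R -> R) f n m :
  {ae leb, forall x, I01 x ->
      nondecreasing_seq (f_ ^~ x) /\ f_ n x @[n --> \oo] --> f x} ->
  (n <= m)%N -> {ae leb, forall x, I01 x -> f_ n x <= f_ m x}.
Proof.
case=> N [mN N0 sub] nm; exists N; split => //.
by apply: subset_trans sub => s /=; apply: contra_not => h /h [nd _]; exact: nd.
Qed.

Lemma ae_nondecreasing_le_lim (f_ : nat -> R -> R) f n :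
  {ae leb, forall x, I01 x ->
      nondecreasing_seq (f_ ^~ x) /\ f_ n x @[n --> \oo] --> f x} ->
  {ae leb, forall x, I01 x -> f_ n x <= f x}.
Proof.
case=> N [mN N0 sub]; exists N; split => //.
apply: subset_trans sub => s /=; apply: contra_not => h /h [nd cv].
rewrite -(cvg_lim _ cv)//; apply: nondecreasing_cvgn_le => //.
by apply/cvg_ex; eexists; exact: cv.
Qed.

End almost_everywhere.

Section head_integral.
Context {R : realType}.
Implicit Types (f g : R -> R) (A : set R) (l c x s t : R).

(** For nonnegative [f] this is the integral of [rearr f] over [(0, x)], with the area
    under its graph measured by horizontal slices. In this form invariance under
    rearrangement and the Fatou property are inherited from the distribution function. *)
Definition head_integral x f : \bar R :=
  \int[leb]_(l in `]0%R, +oo[) mine x%:E (distf f l).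

Lemma mfunI_nneg_measurable f : mfunI_nneg f -> measurable_fun I01 f.
Proof. by case. Qed.

Lemma distf_absf f l : mfunI_nneg f -> distf (absf f) l = distf f l.
Proof.
move=> [_ f0]; congr (leb _); apply/seteqP; split => x /= [Ix];
  by rewrite ger0_norm ?f0.
Qed.

Let mmin f x A : measurable_fun I01 f ->
  measurable_fun A (fun l => mine x%:E (distf f l)).
Proof.
move=> mf; apply: measurable_mine; first exact: measurable_cst.
exact: measurable_funTS (measurable_distf mf).
Qed.

Let min_ge0 f x l : 0 <= x -> (0 <= mine x%:E (distf f l))%E.
Proof. by move=> x0; rewrite le_min lee_fin x0 distf_ge0. Qed.

Lemma head_integral_ge0 f x : 0 <= x -> (0 <= head_integral x f)%E.
Proof. by move=> x0; apply: integral_ge0 => l _; exact: min_ge0. Qed.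

(** Bounding [mine x (distf f l)] by [x] below height [c] and by [distf f l] above it.
    Together with [head_integral_ge] this says that [head_integral x f] is the
    K-functional of [f] between L^1 and L^oo, an infimum over [c]; homogeneity and
    subadditivity, invisible on the definition, are obvious on the infimum. *)
Lemma head_integral_le f x c : measurable_fun I01 f -> 0 <= x -> 0 <= c ->
  (head_integral x f <=
   (c * x)%:E + \int[leb]_(s in I01) (Num.max 0 (f s - c))%:E)%E.
Proof.
move=> mf x0 c0; rewrite -integral_distf// /head_integral.
rewrite (@itv_bndbnd_setU _ _ _ (BRight c)) ?bnd_simp//.
rewrite ge0_integral_setU//; last 3 first.
- exact: mmin.
- by move=> l _; exact: min_ge0.
- apply/disj_setPLR => l /=; rewrite !in_itv/= andbT => /andP[_ lc].
  by apply/negP; rewrite -leNgt.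
apply: leeD.
  apply: (@le_trans _ _ (\int[leb]_(_ in `]0%R, c]) x%:E)%E).
    apply: ge0_le_integral => //; [by move=> *; exact: min_ge0|exact: mmin|].
    by move=> l _; rewrite ge_min lexx.
  rewrite integral_cst//= lebesgue_measure_itv/= lte_fin.
  move: c0; rewrite le_eqVlt => /predU1P[<-|c0].
    by rewrite ltxx mule0 mul0r.
  by rewrite c0 oppr0 adde0 -EFinM mulrC.
apply: ge0_le_integral => //; [by move=> *; exact: min_ge0|exact: mmin| |].
  exact: measurable_funTS (measurable_distf mf).
by move=> l _; rewrite ge_min lexx orbT.
Qed.

(** The infimum is attained at [c = rearr f x], the height at which [distf f]
    crosses [x], since there the bound of [head_integral_le] loses nothing. *)
Lemma head_integral_ge f x : mfunI_nneg f -> 0 < x ->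
  exists2 c, 0 <= c &
  ((c * x)%:E + \int[leb]_(s in I01) (Num.max 0 (f s - c))%:E
   <= head_integral x f)%E.
Proof.
move=> f_nn x0; have mf := mfunI_nneg_measurable f_nn.
exists (rearr f x); first exact: rearr_ge0.
have c0 := rearr_ge0 f x.
rewrite -integral_distf//.
set c := rearr f x in c0 *.
have lt_c l : 0 <= l -> (l < c)%R -> (x%:E <= distf f l)%E.
  by move=> l0; rewrite rearr_gt// distf_absf// => /ltW.
have ge_c l : 0 <= l -> (c <= l)%R -> (distf f l <= x%:E)%E.
  by move=> l0; rewrite rearr_le// distf_absf.
apply: (@le_trans _ _ (\int[leb]_(l in `]0%R, c[ `|` `]c, +oo[)
    mine x%:E (distf f l))%E); last first.
  apply: ge0_subset_integral => //.
  - exact: measurableU.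
  - exact: mmin.
  - by move=> l _; apply: min_ge0; exact: ltW.
  - move=> l /= []; rewrite !in_itv/= ?andbT; first by case/andP.
    exact: le_lt_trans.
rewrite ge0_integral_setU//; last 3 first.
- exact: mmin.
- by move=> l _; apply: min_ge0; exact: ltW.
- apply/disj_setPLR => l /=; rewrite !in_itv/= andbT => /andP[_ /ltW lc].
  by apply/negP; rewrite -leNgt.
apply: leeD.
  apply: (@le_trans _ _ (\int[leb]_(_ in `]0%R, c[) x%:E)%E).
    rewrite integral_cst//= lebesgue_measure_itv/= lte_fin.
    move: c0; rewrite le_eqVlt => /predU1P[<-|c0].
      by rewrite ltxx mule0 mul0r.
    by rewrite c0 oppr0 adde0 -EFinM mulrC.
  apply: ge0_le_integral => //; [by move=> *; rewrite lee_fin ltW|exact: mmin|].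
  move=> l /=; rewrite in_itv/= => /andP[l0 lc].
  by rewrite le_min lexx/= lt_c// ltW.
apply: ge0_le_integral => //; [|exact: mmin|].
  exact: measurable_funTS (measurable_distf mf).
move=> l /=; rewrite in_itv/= andbT => cl.
by rewrite le_min lexx andbT ge_c// ltW// (le_lt_trans c0).
Qed.

Lemma measurable_excess f c : measurable_fun I01 f ->
  measurable_fun I01 (fun s => (Num.max 0 (f s - c))%:E).
Proof.
move=> mf; apply/measurable_EFinP; apply: measurable_maxr => //.
by apply: measurable_funB => //; exact: measurable_cst.
Qed.

Lemma head_integral_rearr f x : mfunI_nneg f ->
  head_integral x (rearr f) = head_integral x f.
Proof.
move=> f_nn; apply: eq_integral => l; rewrite inE/= in_itv/= andbT => l0.
by rewrite distf_rearr ?distf_absf ?ltW//; case: f_nn.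
Qed.

Lemma head_integral_mono f g x : mfunI_nneg f -> mfunI_nneg g -> 0 <= x ->
  {ae leb, forall s, I01 s -> f s <= g s} ->
  (head_integral x f <= head_integral x g)%E.
Proof.
move=> [mf _] [mg _] x0 fg; apply: ge0_le_integral => //.
- by move=> *; exact: min_ge0.
- exact: mmin.
- exact: mmin.
- by move=> l _; rewrite le_min !ge_min lexx/= distf_ae_le ?orbT.
Qed.

(** Adding the optimal heights of [f] and [g] gives an admissible height for the
    sum, because the excess of a sum is at most the sum of the excesses. *)
Lemma head_integralD f g x : mfunI_nneg f -> mfunI_nneg g -> 0 < x ->
  (head_integral x (fun s => (f s + g s)%R) <= head_integral x f + head_integral x g)%E.
Proof.
move=> f_nn g_nn x0; have [mf mg] := (f_nn.1, g_nn.1).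
have [c c0 cf] := head_integral_ge f_nn x0.
have [d d0 dg] := head_integral_ge g_nn x0.
apply: le_trans (leeD cf dg); rewrite addeACA.
apply: le_trans (head_integral_le (c := c + d) _ _ _) _; first exact: measurable_funD.
- exact: ltW.
- exact: addr_ge0.
rewrite mulrDl EFinD leeD2l// -ge0_integralD//; first last.
- exact: measurable_excess.
- by move=> s _; rewrite lee_fin le_max lexx.
- exact: measurable_excess.
- by move=> s _; rewrite lee_fin le_max lexx.
- exact: measurable_I01.
apply: ge0_le_integral.
- exact: measurable_I01.
- by move=> s _; rewrite lee_fin le_max lexx.
- by apply: measurable_excess; exact: measurable_funD.
- by apply: emeasurable_funD; exact: measurable_excess.
- move=> s _; rewrite lee_fin ge_max addr_ge0 ?le_max ?lexx//=.
  by rewrite opprD addrACA lerD// le_max lexx orbT.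
Qed.

Let head_integralZ_le (a : R) f x : 0 <= a -> mfunI_nneg f -> 0 < x ->
  (head_integral x (fun s => (a * f s)%R) <= a%:E * head_integral x f)%E.
Proof.
move=> a0 f_nn x0; have mf := f_nn.1.
have [c c0 cf] := head_integral_ge f_nn x0.
apply: (le_trans _ (lee_wpmul2l _ cf)); last by rewrite lee_fin.
rewrite muleDr//.
apply: le_trans (head_integral_le (c := a * c) _ _ _) _.
- by apply: measurable_funM => //; exact: measurable_cst.
- exact: ltW.
- exact: mulr_ge0.
rewrite -mulrA EFinM leeD2l// -ge0_integralZl_EFin//; first last.
- exact: measurable_excess.
- by move=> s _; rewrite lee_fin le_max lexx.
- exact: measurable_I01.
rewrite le_eqVlt; apply/orP; left; apply/eqP; apply: eq_integral => s _.
by rewrite -EFinM -mulrBr -(mulr0 a) -maxr_pMr// mulr0.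
Qed.

Lemma mfunI_nnegZ (a : R) f : 0 <= a -> mfunI_nneg f -> mfunI_nneg (fun s => a * f s).
Proof.
move=> a0 [mf f0]; split => [|s Is]; last by rewrite mulr_ge0// f0.
by apply: measurable_funM => //; exact: measurable_cst.
Qed.

Lemma head_integralZ (a : R) f x : 0 <= a -> mfunI_nneg f -> 0 < x ->
  head_integral x (fun s => (a * f s)%R) = (a%:E * head_integral x f)%E.
Proof.
move=> a0 f_nn x0; apply/le_anti; rewrite head_integralZ_le//=.
have [->|a_neq0] := eqVneq a 0; first by rewrite mul0e head_integral_ge0// ltW.
have a_gt0 : 0 < a by rewrite lt_neqAle eq_sym a_neq0.
have /= := @head_integralZ_le a^-1 _ x _ (mfunI_nnegZ a0 f_nn) x0.
under eq_fun do rewrite mulKf ?gt_eqF//.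
rewrite invr_ge0 => /(_ a0) h.
apply: le_trans (lee_wpmul2l _ h) _; first by rewrite lee_fin.
by rewrite muleA -EFinM mulfV ?gt_eqF// mul1e.
Qed.

(** The easy half of the Hardy-Littlewood inequality: on a set of measure at most
    [x], split [f] at the optimal height. *)
Lemma integral_le_head_integral f x A : mfunI_nneg f -> 0 < x ->
  measurable A -> A `<=` I01 -> (leb A <= x%:E)%E ->
  (\int[leb]_(s in A) (f s)%:E <= head_integral x f)%E.
Proof.
move=> f_nn x0 mA AI Ax; have mf := f_nn.1.
have [c c0 cf] := head_integral_ge f_nn x0.
apply: le_trans cf.
have mE : measurable_fun A (fun s => (Num.max 0 (f s - c))%:E).
  by apply: measurable_funS (measurable_excess c mf) => //; exact: measurable_I01.
apply: (@le_trans _ _ (\int[leb]_(s in A) (c%:E + (Num.max 0 (f s - c))%:E))%E).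
  apply: ge0_le_integral => //.
  - by move=> s /AI /f_nn.2; rewrite lee_fin.
  - apply/measurable_EFinP; apply: measurable_funS mf => //.
    exact: measurable_I01.
  - by apply: emeasurable_funD => //; exact: measurable_cst.
  - by move=> s _; rewrite -EFinD lee_fin -lerBlDl le_max lexx orbT.
rewrite ge0_integralD//; last first.
- by move=> s _; rewrite lee_fin le_max lexx.
apply: leeD.
  rewrite integral_cst// EFinM; apply: lee_wpmul2l => //; by rewrite lee_fin.
apply: ge0_subset_integral => //.
- exact: measurable_I01.
- exact: measurable_excess.
- by move=> s _; rewrite lee_fin le_max lexx.
Qed.

Lemma head_integral1 f : mfunI_nneg f ->
  head_integral 1 f = (\int[leb]_(s in I01) (f s)%:E)%E.
Proof.
move=> f_nn; apply/le_anti/andP; split; last first.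
  apply: integral_le_head_integral => //; first exact: measurable_I01.
  by rewrite leb_I01.
have := head_integral_le f_nn.1 (@ler01 R) (lexx 0); rewrite mul0r add0e.
move/le_trans; apply; rewrite le_eqVlt; apply/orP; left; apply/eqP.
apply: eq_integral => s; rewrite inE => Is.
by rewrite subr0 max_r// f_nn.2.
Qed.

(** Outside a null set the superlevel sets increase to that of the limit, because
    they are defined by a strict inequality. *)
Lemma distf_fatou (f_ : nat -> R -> R) f l :
  (forall n, measurable_fun I01 (f_ n)) -> measurable_fun I01 f ->
  {ae leb, forall x, I01 x ->
    nondecreasing_seq (f_ ^~ x) /\ f_ n x @[n --> \oo] --> f x} ->
  distf (f_ n) l @[n --> \oo] --> distf f l.
Proof.
move=> mf_ mf [N [mN N0 sub]].
have offN x : ~ N x -> I01 x ->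
    nondecreasing_seq (f_ ^~ x) /\ f_ n x @[n --> \oo] --> f x.
  by move=> Nx Ix; apply: contrapT => h; apply/Nx/sub => /= /(_ Ix).
pose F g := [set x | (I01 x /\ l < g x)%R] `\` N.
have mF g : measurable_fun I01 g -> measurable (F g).
  by move=> mg; apply: measurableD => //; exact: measurable_superlevel.
have FE g : measurable_fun I01 g -> distf g l = leb (F g).
  move=> mg; apply/le_anti/andP; split; last first.
    apply: le_measure; rewrite ?inE; [exact: mF|exact: measurable_superlevel|].
    by move=> x [].
  rewrite -[leRHS]adde0 -N0; apply: (@le_trans _ _ (leb (F g `|` N))); last first.
    by apply: measureU2 => //; exact: mF.
  apply: le_measure; rewrite ?inE; first exact: measurable_superlevel.
    by apply: measurableU => //; exact: mF.
  by move=> x Fx; have [?|?] := pselect (N x); [right|left].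
rewrite FE//; under eq_fun do rewrite FE//.
rewrite (_ : F f = \bigcup_n F (f_ n)).
  apply: nondecreasing_cvg_mu => [n||n m nm].
  - exact: mF.
  - by apply: bigcup_measurable => n _; exact: mF.
  - apply/subsetPset => x [[Ix fx] Nx]; split => //; split => //.
    by rewrite (lt_le_trans fx)//; apply: (offN x Nx Ix).1.
apply/seteqP; split => [x [[Ix fx] Nx]|x [n _ [[Ix fx] Nx]]]; last first.
  split => //; split => //; rewrite (lt_le_trans fx)//.
  have [nd cv] := offN x Nx Ix.
  rewrite -(cvg_lim _ cv)//; apply: nondecreasing_cvgn_le => //.
  by apply/cvg_ex; eexists; exact: cv.
have [nd cv] := offN x Nx Ix.
have /cvgrPdist_lt/(_ (f x - l)) : f_ n x @[n --> \oo] --> f x by [].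
rewrite subr_gt0 => /(_ fx) [n _ /(_ n (leqnn n)) /=] h.
exists n => //; split => //; split => //.
by move: h => /(le_lt_trans (ler_norm _)); rewrite ltrD2l ltrN2.
Qed.

Lemma head_integral_fatou (f_ : nat -> R -> R) f x : 0 <= x ->
  (forall n, mfunI_nneg (f_ n)) -> mfunI_nneg f ->
  {ae leb, forall x, I01 x ->
    nondecreasing_seq (f_ ^~ x) /\ f_ n x @[n --> \oo] --> f x} ->
  head_integral x (f_ n) @[n --> \oo] --> head_integral x f.
Proof.
move=> x0 nf_ nf aef; have mf_ n := (nf_ n).1; have mf := nf.1.
rewrite /head_integral.
have -> : (fun l => mine x%:E (distf f l)) =
    (fun l => limn (fun n => mine x%:E (distf (f_ n) l))).
  apply/funext => l; apply/esym/cvg_lim => //.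
  apply: nondecreasing_cvg_mine; last exact: distf_fatou.
  by move=> n m nm; apply: distf_ae_le => //; exact: ae_nondecreasing_le aef nm.
apply: cvg_monotone_convergence => //.
- by move=> n; exact: mmin.
- by move=> n l _; exact: min_ge0.
- move=> l _ n m nm; rewrite le_min !ge_min lexx/= distf_ae_le ?orbT//.
  exact: ae_nondecreasing_le aef nm.
Qed.

Lemma head_integral_indic_le x t : 0 <= x -> 0 <= t ->
  (head_integral x (\1_(`]0%R, t[ : set R)) <= (Num.min x t)%:E)%E.
Proof.
move=> x0 t0; have mI : measurable_fun I01 (\1_(`]0, t[ : set R) : R -> R).
  by apply: measurable_indic.
rewrite EFin_min le_min; apply/andP; split.
  have := head_integral_le mI x0 (@ler01 R); rewrite mul1r integral0_eq ?adde0//.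
  by move=> s _; rewrite max_l// subr_le0 indicE lern1 leq_b1.
have := head_integral_le mI x0 (lexx 0); rewrite mul0r add0e => /le_trans; apply.
under eq_integral => s _ do (rewrite subr0 max_r; last by rewrite indicE).
rewrite integral_indic//; last exact: measurable_I01.
apply: (@le_trans _ _ (leb (`]0%R, t[ : set R))).
  apply: le_measure; rewrite ?inE//.
  by apply: measurableI => //; exact: measurable_I01.
rewrite lebesgue_measure_itv/= lte_fin; case: ifP => _; last by rewrite lee_fin.
by rewrite oppr0 adde0.
Qed.

End head_integral.

(** * Functionals with the properties of an r.i. norm *)

Section gauges.
Context {R : realType}.
Implicit Types (f g : R -> R) (N M : (R -> R) -> \bar R).

(** The axioms of an r.i. norm that survive multiplication by a constant, finite
    sums and suprema; the three remaining ones (definiteness, finiteness on bounded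
    functions, control of the L^1 norm) only have to be checked once, for the final
    norm. *)
Record ri_gauge N : Prop := RiGauge {
  gauge_ge0 : forall f, mfunI_nneg f -> (0 <= N f)%E ;
  gaugeZ : forall (a : R) f, 0 <= a -> mfunI_nneg f ->
    N (fun x => a * f x) = (a%:E * N f)%E ;
  gaugeD : forall f g, mfunI_nneg f -> mfunI_nneg g ->
    (N (fun x => f x + g x)%R <= N f + N g)%E ;
  gauge_mono : forall f g, mfunI_nneg f -> mfunI_nneg g ->
    {ae leb, forall x, I01 x -> f x <= g x} -> (N f <= N g)%E ;
  gauge_fatou : forall (f_ : nat -> R -> R) f,
    (forall n, mfunI_nneg (f_ n)) -> mfunI_nneg f ->
    {ae leb, forall x, I01 x ->
      nondecreasing_seq (f_ ^~ x) /\ f_ n x @[n --> \oo] --> f x} ->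
    N (f_ n) @[n --> \oo] --> N f ;
  gauge_rearr : forall f, mfunI_nneg f -> N (rearr f) = N f
}.

Lemma ri_gauge_head_integral x : 0 < x -> ri_gauge (@head_integral R x).
Proof.
move=> x0; have x0' := ltW x0; split.
- by move=> f _; exact: head_integral_ge0.
- by move=> a f a0 f_nn; exact: head_integralZ.
- by move=> f g *; exact: head_integralD.
- by move=> f g *; exact: head_integral_mono.
- by move=> f_ f *; exact: head_integral_fatou.
- by move=> f *; exact: head_integral_rearr.
Qed.

Lemma ri_gaugeZ N (c : R) : 0 <= c -> ri_gauge N -> ri_gauge (fun f => c%:E * N f)%E.
Proof.
move=> c0 gN; have c0' : (0 <= c%:E)%E by rewrite lee_fin.
split.
- by move=> f /(gauge_ge0 gN) ?; exact: mule_ge0.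
- by move=> a f a0 /(gaugeZ gN a0) ->; rewrite muleCA.
- move=> f g f_nn g_nn; rewrite -ge0_muleDr; try exact: (gauge_ge0 gN).
  by apply: lee_wpmul2l => //; exact: gaugeD.
- by move=> f g f_nn g_nn fg; apply: lee_wpmul2l => //; exact: gauge_mono.
- by move=> f_ f f_nn fnn aef; apply: cvgeZl => //; exact: gauge_fatou.
- by move=> f f_nn; rewrite gauge_rearr.
Qed.

Lemma ri_gaugeD N M : ri_gauge N -> ri_gauge M -> ri_gauge (fun f => N f + M f)%E.
Proof.
move=> gN gM; split.
- by move=> f f_nn; apply: adde_ge0; [exact: (gauge_ge0 gN)|exact: (gauge_ge0 gM)].
- move=> a f a0 f_nn; rewrite (gaugeZ gN)// (gaugeZ gM)// ge0_muleDr//.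
    exact: (gauge_ge0 gN).
  exact: (gauge_ge0 gM).
- move=> f g f_nn g_nn; rewrite addeACA; apply: leeD; first exact: (gaugeD gN).
  exact: (gaugeD gM).
- move=> f g f_nn g_nn fg; apply: leeD; first exact: (gauge_mono gN).
  exact: (gauge_mono gM).
- move=> f_ f f_nn fnn aef; apply: cvgeD.
  + by apply: ge0_adde_def; rewrite inE; [exact: (gauge_ge0 gN)|exact: (gauge_ge0 gM)].
  + exact: (gauge_fatou gN).
  + exact: (gauge_fatou gM).
- by move=> f f_nn; rewrite (gauge_rearr gN)// (gauge_rearr gM).
Qed.

Lemma ri_gauge_sum (N_ : nat -> (R -> R) -> \bar R) n :
  (forall k, ri_gauge (N_ k)) -> ri_gauge (fun f => \sum_(k < n.+1) N_ k f)%E.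
Proof.
move=> gN; elim: n => [|n IHn].
  rewrite (_ : (fun f => _) = N_ 0%N) //.
  by apply/funext => f; rewrite big_ord1.
rewrite (_ : (fun f => _) = (fun f => \sum_(k < n.+1) N_ k f + N_ n.+1 f)%E).
  exact: ri_gaugeD.
by apply/funext => f; rewrite big_ord_recr.
Qed.

(** The Fatou property passes to the supremum because, for monotone functionals,
    it is itself an exchange of two suprema. *)
Lemma ri_gauge_sup (N_ : nat -> (R -> R) -> \bar R) :
  (forall k, ri_gauge (N_ k)) ->
  ri_gauge (fun f => ereal_sup (range (fun n => N_ n f))).
Proof.
move=> gN.
have ub n f : (N_ n f <= ereal_sup (range (fun n => N_ n f)))%E.
  by apply: ereal_sup_ubound; exists n.
have mono f g : mfunI_nneg f -> mfunI_nneg g ->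
    {ae leb, forall x, I01 x -> f x <= g x} ->
    (ereal_sup (range (fun n => N_ n f)) <= ereal_sup (range (fun n => N_ n g)))%E.
  move=> f_nn g_nn fg; apply: ge_ereal_sup => _ [n _ <-].
  by apply: le_trans (ub n g); exact: gauge_mono.
split => //.
- by move=> f f_nn; apply: le_trans (ub 0%N f); exact: gauge_ge0.
- move=> a f a0 f_nn.
  transitivity (ereal_sup (range (fun n => a%:E * N_ n f))%E).
    by congr ereal_sup; apply: eq_imagel => n _; rewrite gaugeZ.
  rewrite -ereal_supZl//; last by apply/set0P; exists (N_ 0%N f); exists 0%N.
  by rewrite image_comp.
- move=> f g f_nn g_nn; apply: ge_ereal_sup => _ [n _ <-].
  by apply: le_trans (leeD (ub n f) (ub n g)); exact: gaugeD.
- move=> f_ f f_nn fnn aef.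
  pose S f := ereal_sup (range (fun n => N_ n f)).
  have nd : nondecreasing_seq (S \o f_).
    by move=> n m nm; apply: mono => //; exact: ae_nondecreasing_le aef nm.
  suff SE : S f = ereal_sup (range (S \o f_)).
    by rewrite -/(S f) SE; exact: (ereal_nondecreasing_cvgn nd).
  apply/le_anti/andP; split; last first.
    apply: ge_ereal_sup => _ [n _ <-]; apply: mono => //.
    exact: ae_nondecreasing_le_lim aef.
  apply: ge_ereal_sup => _ [k _ <-].
  have cv := gauge_fatou (gN k) f_nn fnn aef.
  rewrite -(cvg_lim _ cv)//; apply: lime_le; first by apply/cvg_ex; eexists; exact: cv.
  apply: nearW => n; apply: (le_trans (ub k _)).
  by apply: ereal_sup_ubound; exists n.
- move=> f f_nn; congr ereal_sup; apply: eq_imagel => n _.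
  exact: gauge_rearr.
Qed.

Lemma mfunI_nneg_cst (a : R) : 0 <= a -> mfunI_nneg (fun _ => a).
Proof. by move=> a0; split => // ; exact: measurable_cst. Qed.

Lemma mfunI_nneg_indic (A : set R) : measurable A -> mfunI_nneg (\1_A : R -> R).
Proof. by move=> mA; split=> [|x _]; [exact: measurable_indic|rewrite indicE]. Qed.

Lemma ri_norm_gauge N (C : R) : ri_gauge N -> 0 < C ->
  (N (\1_I01) < +oo)%E ->
  (forall f, mfunI_nneg f -> (\int[leb]_(x in I01) (f x)%:E <= C%:E * N f)%E) ->
  ri_norm N.
Proof.
move=> gN C0 N1 NL1; split.
- exact: gauge_ge0.
- move=> f f_nn; split => [Nf0|f0].
    have /(NL1 _) := f_nn; rewrite Nf0 mule0 => if0.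
    have : (\int[leb]_(x in I01) `|(f x)%:E| = 0)%E.
      apply/le_anti/andP; split; last exact: integral_ge0.
      move: if0; congr (_ <= _)%E; apply: eq_integral => x; rewrite inE => Ix.
      by rewrite gee0_abs// lee_fin; exact: f_nn.2.
    move/ae_eq_integral_abs => /(_ measurable_I01).
    have mf : measurable_fun I01 (EFin \o f) by apply/measurable_EFinP; exact: f_nn.1.
    move=> /(_ mf) [M [mM M0 sub]]; exists M; split=> //.
    by apply: subset_trans sub => x /=; apply: contra_not => h /h [].
  have nn0 := mfunI_nneg_cst (lexx 0).
  apply/le_anti; rewrite gauge_ge0// andbT.
  have <- : N (fun x => 0 * 0) = 0%E by rewrite (gaugeZ gN (lexx _) nn0) mul0e.
  rewrite mulr0; apply: (gauge_mono gN) => //.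
  case: f0 => M [mM M0 sub]; exists M; split=> //.
  by apply: subset_trans sub => x /=; apply: contra_not => h /h ->.
- exact: gaugeZ.
- exact: gaugeD.
- exact: gauge_mono.
- move=> f_ f f_nn fnn aef; split; last exact: gauge_fatou.
  by move=> n m nm /=; apply: (gauge_mono gN) => //; exact: ae_nondecreasing_le aef nm.
- by [].
- by exists C.
- by move=> f f_nn; rewrite gauge_rearr.
Qed.

End gauges.

(** * Inclusions between r.i. spaces are continuous *)

Section embedding.
Context {R : realType}.
Implicit Types (f g : R -> R) (rho : (R -> R) -> \bar R).

Lemma mfunI_nnegD f g : mfunI_nneg f -> mfunI_nneg g -> mfunI_nneg (fun x => f x + g x).
Proof.
move=> [mf f0] [mg g0]; split => [|x Ix]; first exact: measurable_funD.
by rewrite addr_ge0 ?f0 ?g0.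
Qed.

Lemma mfunI_nneg_sum (g_ : nat -> R -> R) n : (forall k, mfunI_nneg (g_ k)) ->
  mfunI_nneg (fun x => \sum_(k < n) g_ k x).
Proof.
move=> g_nn; elim: n => [|n IHn].
  by under eq_fun do rewrite big_ord0; exact: mfunI_nneg_cst.
by under eq_fun do rewrite big_ord_recr /=; exact: mfunI_nnegD.
Qed.

Lemma mfunI_nneg_abs f : measurable_fun I01 f -> mfunI_nneg (absf f).
Proof. by move=> mf; split=> //; exact: measurableT_comp. Qed.

Lemma ri_norm_abs rho f : ri_norm rho -> mfunI_nneg f -> ri_norm_of rho f = rho f.
Proof.
move=> rn f_nn; have af := mfunI_nneg_abs f_nn.1.
apply/le_anti/andP; split; apply: (ri_mono rn) => //; apply: ae_all => x Ix;
  by rewrite ger0_norm// f_nn.2.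
Qed.

Lemma ri_norm_sum_le rho (g_ : nat -> R -> R) n : ri_norm rho ->
  (forall k, mfunI_nneg (g_ k)) -> (forall k, (rho (g_ k) <= (2^-1 ^+ k)%:E)%E) ->
  (rho (fun x => (\sum_(k < n) g_ k x)%R) <= (2 - 2 * 2^-1 ^+ n)%:E)%E.
Proof.
move=> rn g_nn g_le; elim: n => [|n IHn].
  under eq_fun do rewrite big_ord0; rewrite expr0 mulr1 subrr.
  rewrite le_eqVlt; apply/orP; left; apply/eqP.
  by apply/(ri_eq0 rn); [exact: mfunI_nneg_cst|exact: ae_all].
under eq_fun do rewrite big_ord_recr /=.
apply: le_trans (ri_add rn (mfunI_nneg_sum _ g_nn) (g_nn n)) _.
apply: le_trans (leeD IHn (g_le n)) _.
rewrite -EFinD lee_fin exprS; lra.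
Qed.

(** The closed graph argument for Banach function norms. If no constant worked,
    there would be functions [g_ n] with [rhoZ (g_ n) <= 2^-n] and [rhoX (g_ n) >= n].
    Their sum is finite almost everywhere since its integral is, it has finite
    [rhoZ]-norm by the Fatou property, and yet it dominates every [g_ n], so that its
    [rhoX]-norm is infinite. *)
Lemma ri_embedding rhoZ rhoX : ri_norm rhoZ -> ri_norm rhoX ->
  ri_space rhoZ `<=` ri_space rhoX ->
  exists2 C : R, 0 < C & forall f, mfunI_nneg f -> (rhoX f <= C%:E * rhoZ f)%E.
Proof.
move=> rZ rX ZX; apply: contrapT => noC.
have {noC} bad n : exists g, [/\ mfunI_nneg g, (rhoZ g <= (2^-1 ^+ n)%:E)%E &
    (n%:R%:E <= rhoX g)%E].
  have [f f_nn ltf] : exists2 f, mfunI_nneg f & ((4 ^+ n)%:E * rhoZ f < rhoX f)%E.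
    apply: contrapT => h; apply: noC; exists (4 ^+ n); first by rewrite exprn_gt0.
    by move=> f f_nn; rewrite leNgt; apply/negP => ?; apply: h; exists f.
  have n4 : 0 < 4 ^+ n :> R by rewrite exprn_gt0.
  have Zfin : rhoZ f \is a fin_num.
    rewrite ge0_fin_numE ?(ri_ge0 rZ)// ltNge leye_eq; apply/negP => /eqP Zoo.
    by move: ltf; rewrite Zoo gt0_muley ?lte_fin// ltNge leey.
  have Zgt0 : 0 < fine (rhoZ f).
    rewrite lt_neqAle fine_ge0 ?(ri_ge0 rZ)// andbT eq_sym; apply/negP => /eqP Z0.
    have Zf0 : rhoZ f = 0%E by rewrite -(fineK Zfin) Z0.
    have /(ri_eq0 rX f_nn) Xf0 := (ri_eq0 rZ f_nn).1 Zf0.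
    by move: ltf; rewrite Zf0 Xf0 mule0 ltxx.
  pose a := 2^-1 ^+ n / fine (rhoZ f).
  have a0 : 0 < a by rewrite divr_gt0// exprn_gt0.
  (* rescaling [f] makes its [rhoZ]-norm equal to 2^-n and its [rhoX]-norm at
     least 4^n / 2^n >= n *)
  exists (fun x => a * f x); split; first exact: mfunI_nnegZ (ltW a0) _.
    rewrite (ri_homo rZ (ltW a0) f_nn) -(fineK Zfin) -EFinM lee_fin /a.
    by rewrite divfK// gt_eqF.
  rewrite (ri_homo rX (ltW a0) f_nn).
  apply: le_trans (lee_wpmul2l _ (ltW ltf)); last by rewrite lee_fin ltW.
  rewrite -(fineK Zfin) -!EFinM lee_fin /a mulrCA mulrA mulrA divfK ?gt_eqF//.
  rewrite -exprMn (_ : 4 * 2^-1 = 2); last by lra.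
  by rewrite -natrX ler_nat ltnW// ltn_expl.
have [g_ g_P] := choice bad.
have g_nn n : mfunI_nneg (g_ n) by case: (g_P n).
pose s n x := \sum_(k < n) g_ k x.
have s_nn n : mfunI_nneg (s n) by exact: mfunI_nneg_sum.
have s_nd x : I01 x -> nondecreasing_seq (s ^~ x).
  move=> Ix; apply/nondecreasing_seqP => n.
  by rewrite /s big_ord_recr/= lerDl (g_nn n).2.
pose h x := limn (EFin \o s ^~ x).
have es_nd x : I01 x -> nondecreasing_seq (EFin \o s ^~ x).
  by move=> Ix n m nm; rewrite lee_fin; exact: s_nd.
have s_h x : I01 x -> (s n x)%:E @[n --> \oo] --> h x.
  by move=> Ix; apply: ereal_nondecreasing_is_cvgn; exact: es_nd.
have mh : measurable_fun I01 h.
  apply: emeasurable_fun_cvg s_h => n; apply/measurable_EFinP; exact: (s_nn n).1.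
have h_ge0 x : I01 x -> (0 <= h x)%E.
  move=> Ix; apply: lime_ge; first exact: ereal_nondecreasing_is_cvgn (es_nd x Ix).
  by apply: nearW => n; rewrite lee_fin (s_nn n).2.
have sZ n : (rhoZ (s n) <= 2%:E)%E.
  apply: le_trans (ri_norm_sum_le n rZ g_nn _) _; first by move=> k; case: (g_P k).
  by rewrite lee_fin lerBlDr lerDl mulr_ge0// exprn_ge0.
(* the [rhoZ]-norms of the partial sums are at most 2, and [rhoZ] controls the
   integral *)
have h_int : leb.-integrable I01 h.
  apply/integrableP; split => //.
  under eq_integral => x do [rewrite inE => Ix; rewrite gee0_abs ?h_ge0//].
  have [C C0 LC] := ri_L1 rZ.
  apply: (@le_lt_trans _ _ (C * 2)%:E); last exact: ltry.
  rewrite /h monotone_convergence//; last 3 first.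
  - exact: measurable_I01.
  - by move=> n; apply/measurable_EFinP; exact: (s_nn n).1.
  - by move=> n x Ix; rewrite lee_fin (s_nn n).2.
  apply: lime_le.
    apply: ereal_nondecreasing_is_cvgn => n m nm; apply: ge0_le_integral.
    - exact: measurable_I01.
    - by move=> x Ix; rewrite lee_fin (s_nn n).2.
    - by apply/measurable_EFinP; exact: (s_nn n).1.
    - by apply/measurable_EFinP; exact: (s_nn m).1.
    - by move=> x Ix; exact: es_nd.
  apply: nearW => n; apply: le_trans (LC _ (s_nn n)) _.
  by rewrite EFinM; apply: lee_wpmul2l => //; rewrite lee_fin ltW.
pose h' x := fine (h x).
have h'_nn : mfunI_nneg h'.
  split => [|x Ix]; last by rewrite fine_ge0 ?h_ge0.
  exact: measurableT_comp mh.
have aeh : {ae leb, forall x, I01 x ->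
    nondecreasing_seq (s ^~ x) /\ s n x @[n --> \oo] --> h' x}.
  have [|N [mN N0 sub]] := integrable_ae _ h_int; first exact: measurable_I01.
  exists N; split => //; apply: subset_trans sub => x /=.
  apply: contra_not => hfin Ix; split; first exact: s_nd.
  have := s_h x Ix; rewrite -(fineK (hfin Ix)).
  by move/fine_cvgP => [].
have Zh' : (rhoZ h' <= 2%:E)%E.
  have [_ cv] := ri_fatou rZ s_nn h'_nn aeh.
  rewrite -(cvg_lim _ cv)//; apply: lime_le; first by apply/cvg_ex; eexists; exact: cv.
  exact: nearW.
have : ri_space rhoX h'.
  apply: ZX; split; first exact: h'_nn.1.
  by rewrite ri_norm_abs// (le_lt_trans Zh')// ltry.
case=> _; rewrite ri_norm_abs// => Xfin.
have Xge n : (n%:R%:E <= rhoX h')%E.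
  have [_ _ /le_trans] := g_P n; apply; apply: (ri_mono rX) => //.
  have := ae_nondecreasing_le_lim n.+1 aeh.
  case=> N [mN N0 sub]; exists N; split => //; apply: subset_trans sub => x /=.
  apply: contra_not => + Ix => /(_ Ix); apply: le_trans.
  by rewrite /s big_ord_recr/= lerDr (s_nn n).2.
have Xf : rhoX h' \is a fin_num by rewrite ge0_fin_numE// (ri_ge0 rX).
have := Xge (Num.truncn (fine (rhoX h'))).+1.
by rewrite -(fineK Xf) lee_fin leNgt truncnS_gt.
Qed.

End embedding.

(** * Dyadic norms *)

Section powers.
Context {R : realType}.
Implicit Types (x y r : R).

Lemma powR_npos_le x y r : 0 < x -> x <= y -> r <= 0 -> y `^ r <= x `^ r.
Proof.
move=> x0 xy r0; have y0 := lt_le_trans x0 xy.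
rewrite -(opprK r) !(powRN _ (- r)) lef_pV2 ?posrE ?powR_gt0//.
by apply: ge0_ler_powR; rewrite ?nnegrE ?oppr_ge0// ltW.
Qed.

Lemma powR_inv2X n r : (2^-1 ^+ n : R) `^ (- r) = (2 `^ r) ^+ n.
Proof.
elim: n => [|n IHn]; first by rewrite !expr0 powR1.
rewrite !exprS powRM ?exprn_ge0// IHn; congr (_ * _).
by rewrite -powR_inv1// -powRrM mulrN mulN1r opprK.
Qed.

End powers.

Section fundamental_functions.
Context {R : realType}.
Variables (phi : R -> R).
Hypothesis phi_fund : concave_fund_fun phi.

Lemma fund0 : phi 0 = 0.
Proof. by apply/(cff_eq0 phi_fund) => //; rewrite in_itv/= lexx ltr01. Qed.

(** Concavity between [0] and [x], where [phi] vanishes at [0]. *)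
Lemma fund_scale (c x : R) : 0 <= c <= 1 -> 0 <= x < 1 -> c * phi x <= phi (c * x).
Proof.
move=> /andP[c0 c1] /andP[x0 x1].
have c01 : Itv.spec (@Itv.num_sem R) (Itv.Real `[0%Z, 1%Z]) c.
  by rewrite /Itv.spec/= /Itv.num_sem/= num_real in_itv/= c0 c1.
have := cff_concave phi_fund (Itv.mk c01).
move=> /(_ x 0); rewrite !inE/= !in_itv/= x0 x1 lexx ltr01 => /(_ isT isT).
change (- phi (c * x + (1 - c) * 0) <= c * - phi x + (1 - c) * - phi 0 ->
  c * phi x <= phi (c * x)).
rewrite mulr0 addr0 fund0 oppr0 mulr0 addr0 mulrN lerN2.
by [].
Qed.

End fundamental_functions.

Section dyadic.
Context {R : realType}.
Implicit Types (f : R -> R) (q t : R) (c : nat -> R).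

(** Up to constants this is the integral of [rearr f] against the decreasing weight
    [max (2^-n, s) `^ (alpha - 1)], when [q = 2 `^ (1 - alpha)]: the weight is
    comparable to the sum over [k <= n] of [q ^+ k] times the indicator of
    [(0, 2^-k)]. *)
Definition dyadic_sum q n f : \bar R :=
  (\sum_(k < n.+1) (q ^+ k)%:E * head_integral (2^-1 ^+ k) f)%E.

Definition dyadic_norm q c f : \bar R :=
  ereal_sup (range (fun n => (c n)%:E * dyadic_sum q n f)%E).

Lemma ri_gauge_dyadic_sum q n : 0 <= q -> ri_gauge (dyadic_sum q n).
Proof.
move=> q0; apply: (ri_gauge_sum (N_ := fun k f => (q ^+ k)%:E * head_integral (2^-1 ^+ k) f)%E).
move=> k; apply: ri_gaugeZ; first exact: exprn_ge0.
by apply: ri_gauge_head_integral; rewrite exprn_gt0.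
Qed.

Lemma ri_gauge_dyadic_norm q c : 0 <= q -> (forall n, 0 <= c n) ->
  ri_gauge (dyadic_norm q c).
Proof.
move=> q0 c0; apply: (ri_gauge_sup (N_ := fun n f => (c n)%:E * dyadic_sum q n f)%E).
by move=> n; exact: (ri_gaugeZ (c0 n) (ri_gauge_dyadic_sum n q0)).
Qed.

Lemma dyadic_norm_ge q c n f : ((c n)%:E * dyadic_sum q n f <= dyadic_norm q c f)%E.
Proof. by apply: ereal_sup_ubound; exists n. Qed.

Lemma ri_norm_dyadic q c : 0 <= q -> (forall n, 0 <= c n) -> 0 < c 0%N ->
  (dyadic_norm q c (\1_I01) < +oo)%E -> ri_norm (dyadic_norm q c).
Proof.
move=> q0 c0 c00 fin1.
have C0 : 0 < (c 0%N)^-1 by rewrite invr_gt0.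
apply: (@ri_norm_gauge _ _ _ (ri_gauge_dyadic_norm q0 c0) C0 fin1) => f f_nn.
rewrite -head_integral1// lee_pdivlMl//.
apply: le_trans (dyadic_norm_ge q c 0%N f).
by rewrite /dyadic_sum big_ord1 !expr0 mul1e.
Qed.

Definition dyadic_min_sum q n t : R := \sum_(k < n.+1) q ^+ k * Num.min (2^-1 ^+ k) t.

Lemma dyadic_sum_indic_le q n t : 0 <= q -> 0 <= t ->
  (dyadic_sum q n (\1_(`]0%R, t[ : set R)) <= (dyadic_min_sum q n t)%:E)%E.
Proof.
move=> q0 t0; rewrite /dyadic_min_sum -sumEFin; apply: lee_sum => k _.
rewrite EFinM; apply: lee_wpmul2l; first by rewrite lee_fin exprn_ge0.
by apply: head_integral_indic_le => //; rewrite exprn_ge0.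
Qed.

Lemma dyadic_min_sum_le_geometric q n t : 1 < q -> 0 <= t ->
  dyadic_min_sum q n t <= (q - 1)^-1 * (t * q ^+ n.+1).
Proof.
move=> q1 t0.
have q10 : 0 < q - 1 by rewrite subr_gt0.
rewrite -ler_pdivrMl ?invr_gt0// invrK.
apply: (@le_trans _ _ (t * ((q - 1) * \sum_(k < n.+1) q ^+ k))); last first.
  by rewrite -subrX1 ler_wpM2l// gerBl.
rewrite mulrCA ler_wpM2l ?(ltW q10)// mulr_sumr; apply: ler_sum => k _.
rewrite mulrC ler_wpM2r//; first by rewrite exprn_ge0// ltW// (lt_trans ltr01).
by rewrite ge_min lexx orbT.
Qed.

Lemma geometric_sum_le (b : R) n : 0 <= b < 1 -> \sum_(k < n) b ^+ k <= (1 - b)^-1.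
Proof.
move=> /andP[b0 b1]; rewrite -[leRHS]mul1r ler_pdivlMr ?subr_gt0//.
have -> : (\sum_(k < n) b ^+ k) * (1 - b) = 1 - b ^+ n.
  by rewrite mulrC -[1 - b]opprB mulNr -subrX1 opprB.
by rewrite gerBl exprn_ge0.
Qed.

(** Self-similarity under [t |-> 2 * t]; it drives the induction in the next
    lemma. *)
Lemma dyadic_min_sumS q n t :
  dyadic_min_sum q n.+1 t = Num.min 1 t + q / 2 * dyadic_min_sum q n (2 * t).
Proof.
rewrite /dyadic_min_sum big_ord_recl !expr0 mul1r; congr (_ + _).
rewrite mulr_sumr; apply: eq_bigr => k _; rewrite lift0 !exprS.
have -> : Num.min (2^-1 * 2^-1 ^+ k) t = 2^-1 * Num.min (2^-1 ^+ k) (2 * t).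
  by rewrite minr_pMr// mulKf.
ring.
Qed.

(** The terms with [2^-k > t] form an increasing geometric progression and the
    others a decreasing one, both of size [t `^ alpha] where they meet. Instead of
    splitting the sum there, one inducts on [n] with [dyadic_min_sumS]. *)
Lemma dyadic_min_sum_le_powR alpha : 0 < alpha -> alpha < 1 ->
  exists2 C, 0 < C & forall n t, 0 < t <= 2 ->
  dyadic_min_sum (2 `^ (1 - alpha)) n t <= C * t `^ alpha.
Proof.
move=> a0 a1; set q := 2 `^ (1 - alpha).
have pow_gt1 r : 0 < r -> 1 < 2 `^ r :> R.
  by move=> r0; have := gt0_ltr_powR r0 (ler01 : 1 \in Num.nneg) (ler0n _ 2) (ltr1n R 2);
    rewrite powR1.
have q_gt1 : 1 < q by apply: pow_gt1; rewrite subr_gt0.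
have bq : q / 2 * 2 `^ alpha = 1.
  rewrite mulrAC /q -powRD; last by apply/implyP => _; rewrite pnatr_eq0.
  by rewrite subrK powRr1// mulfV.
have b_lt1 : q / 2 < 1.
  by rewrite -[ltRHS]bq ltr_pMr ?pow_gt1// divr_gt0// (lt_trans ltr01).
pose D := (q - 1)^-1; have D0 : 0 < D by rewrite invr_gt0 subr_gt0.
have qD : q * D = D + 1 by rewrite /D; field; rewrite gt_eqF// subr_gt0.
pose B := (1 - q / 2)^-1; have B0 : 0 < B by rewrite invr_gt0 subr_gt0.
pose C := B + 2 * D + 1.
have C0 : 0 < C by rewrite /C; lra.
(* The bound [C * t `^ alpha] alone is exactly preserved by [t |-> 2 * t], which
   leaves no room for the term [Num.min 1 t]; the correction [- D * t] provides it,
   because [q * D = D + 1]. *)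
suff H n : forall t, 0 < t <= 2 -> dyadic_min_sum q n t <= C * t `^ alpha - D * t.
  exists C => // n t t02; apply: le_trans (H n t t02) _.
  by rewrite gerBl mulr_ge0// ltW//; case/andP : t02.
have small t : 0 < t <= 1 -> t <= t `^ alpha.
  by move=> t01; apply: ger1_powR => //; exact: ltW.
have large m t : 1 < t -> t <= 2 -> dyadic_min_sum q m t <= C * t `^ alpha - D * t.
  move=> t1 t2; apply: (@le_trans _ _ (\sum_(k < m.+1) (q / 2) ^+ k)).
    apply: ler_sum => k _; rewrite exprMn ler_wpM2l//; last by rewrite ge_min lexx.
    by rewrite exprn_ge0// ltW// (lt_trans ltr01).
  apply: (@le_trans _ _ B).
    by apply: geometric_sum_le; rewrite b_lt1 andbT divr_ge0// ltW// (lt_trans ltr01).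
  have ta : 1 <= t `^ alpha.
    by rewrite -(powRr0 t); apply: ler_powR; exact: ltW.
  have : C <= C * t `^ alpha by rewrite ler_peMr// ltW.
  have : D * t <= D * 2 by rewrite ler_wpM2l// ltW.
  by rewrite /C; lra.
elim: n => [|n IHn] t /andP[t0 t2].
  have [t1|] := leP t 1; last by move/large; exact.
  rewrite /dyadic_min_sum big_ord1 !expr0 mul1r.
  have ta := small t (introT andP (conj t0 t1)).
  have : 0 <= (C - D - 1) * t `^ alpha.
    by rewrite mulr_ge0 ?powR_ge0// /C; lra.
  have : D * t <= D * t `^ alpha by rewrite ler_wpM2l// ltW.
  have : Num.min 1 t <= t by rewrite ge_min lexx orbT.
  by rewrite !mulrBl mul1r; lra.
have [t1|] := leP t 1; last by move/large; exact.
rewrite dyadic_min_sumS.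
have t22 : 0 < 2 * t <= 2 by rewrite mulr_gt0//= -[leRHS]mulr1 ler_wpM2l.
have /(ler_wpM2l (_ : 0 <= q / 2)) := IHn _ t22.
have b0 : 0 <= q / 2 by rewrite divr_ge0// ltW// (lt_trans ltr01).
move=> /(_ b0) h.
have : Num.min 1 t <= t by rewrite ge_min lexx orbT.
have E : q / 2 * (C * (2 * t) `^ alpha - D * (2 * t)) = C * t `^ alpha - D * t - t.
  rewrite powRM//; last exact: ltW.
  rewrite mulrBr (_ : q / 2 * (C * (2 `^ alpha * t `^ alpha)) =
    (q / 2 * 2 `^ alpha) * (C * t `^ alpha)); last by ring.
  rewrite bq mul1r (_ : q / 2 * (D * (2 * t)) = q * D * t); last by field.
  rewrite qD; ring.
by move: h; rewrite E; lra.
Qed.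

End dyadic.

(** * The operator on nonnegative functions *)

Section hardy.
Context {R : realType}.
Variables (alpha beta : R).
Hypotheses (alpha_lt1 : alpha < 1) (beta_gt0 : 0 < beta)
  (alpha_beta : 1 <= alpha + beta^-1).
Implicit Types (f h : R -> R) (s t : R).

(** The extended-real version of [hardy_op]: for nonnegative [f] it is monotone and
    obeys Tonelli's theorem without any integrability hypothesis. *)
Definition ehardy f t : \bar R :=
  (\int[leb]_(s in `](t `^ beta)%R, 1%R[) (f s * s `^ (alpha - 1))%:E)%E.

Lemma hardy_opE f t : hardy_op alpha beta f t = fine (ehardy f t).
Proof. by []. Qed.

Let above : set (R * R) := [set z | z.1 `^ beta < z.2].

Let measurable_above : measurable above.
Proof.
have -> : above = (fun z : R * R => z.1 `^ beta < z.2) @^-1` [set true].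
  by apply/seteqP; split.
rewrite -[X in measurable X]setTI.
apply: measurable_fun_ltr => //.
exact: (measurableT_comp (@measurable_powR R beta) measurable_fst).
Qed.

Let kernel h (z : R * R) : \bar R :=
  ((h \_ I01) z.2 * z.2 `^ (alpha - 1) * \1_above z)%:E.

Let measurable_kernel h : measurable_fun I01 h -> measurable_fun setT (kernel h).
Proof.
move=> mh; apply/measurable_EFinP; apply: measurable_funM; last exact: measurable_indic.
apply: measurable_funM.
  apply: (measurableT_comp (f := h \_ I01)) => //.
  by apply/(measurable_restrictT _ _).1 => //; exact: measurable_I01.
exact: (measurableT_comp (@measurable_powR R _) measurable_snd).
Qed.

Let kernel_ge0 h z : mfunI_nneg h -> (0 <= kernel h z)%E.
Proof.
move=> [_ h0]; rewrite lee_fin mulr_ge0 ?indicE// mulr_ge0 ?powR_ge0// patchE.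
by case: ifPn => //; rewrite inE => /h0.
Qed.

Let integral_kernel h t : (\int[leb]_s kernel h (t, s) = ehardy h t)%E.
Proof.
rewrite /ehardy [RHS]integral_mkcond; apply: eq_integral => s _.
rewrite /kernel/= !patchE indicE; case: ifPn => sI.
  case: ifPn => st.
    rewrite mem_set ?mulr1//; move: st; rewrite inE/= in_itv/= /above/=.
    by case/andP.
  rewrite memNset ?mulr0// /above/= => ts; move/negP : st; apply.
  by move: sI; rewrite !inE /I01/= !in_itv/= ts => /andP[].
rewrite !mul0r ifN//; apply: contra sI; rewrite !inE /I01/= !in_itv/= => /andP[ts ->].
by rewrite (le_lt_trans _ ts)// powR_ge0.
Qed.

(** A partial integral of a nonnegative function measurable on the product. *)
Lemma measurable_ehardy h : mfunI_nneg h -> measurable_fun I01 (ehardy h).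
Proof.
move=> h_nn; have -> : ehardy h = fun t => (\int[leb]_s kernel h (t, s))%E.
  by apply/funext => t; rewrite integral_kernel.
apply: measurable_funTS.
apply: (@measurable_fun_fubini_tonelli_F _ _ _ _ _ leb (kernel h)).
  by apply: measurable_kernel; exact: h_nn.1.
by move=> z; exact: kernel_ge0.
Qed.

Lemma measurable_hardy_op f : measurable_fun I01 f ->
  measurable_fun I01 (hardy_op alpha beta f).
Proof.
move=> mf.
pose fp s := Num.max (f s) 0; pose fm s := Num.max (- f s) 0.
have fp_nn : mfunI_nneg fp.
  split; first by apply: measurable_maxr => //; exact: measurable_cst.
  by move=> s _; rewrite le_max lexx orbT.
have fm_nn : mfunI_nneg fm.
  split; first by apply: measurable_maxr; [exact: measurable_funN|exact: measurable_cst].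
  by move=> s _; rewrite le_max lexx orbT.
have -> : hardy_op alpha beta f = fine \o (fun t => ehardy fp t - ehardy fm t)%E.
  apply/funext => t; rewrite hardy_opE /ehardy /= integralE; congr (fine (_ - _)%E).
    apply: eq_integral => s _; rewrite funeposE /fp -EFin_max.
    by rewrite maxr_pMl ?powR_ge0// mul0r.
  apply: eq_integral => s _; rewrite funenegE /fm -EFinN -EFin_max.
  by rewrite maxr_pMl ?powR_ge0// mul0r mulNr.
apply: measurableT_comp => //.
by apply: emeasurable_funB; exact: measurable_ehardy.
Qed.

Let hardy_itv_sub t : `]t `^ beta, 1[%classic `<=` @I01 R.
Proof.
move=> s; rewrite /I01/= !in_itv/= => /andP[ts ->].
by rewrite (le_lt_trans _ ts)// powR_ge0.
Qed.

Let measurable_integrand f t : measurable_fun I01 f ->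
  measurable_fun (`]t `^ beta, 1[ : set R) (fun s => (f s * s `^ (alpha - 1))%:E).
Proof.
move=> mf; apply/measurable_EFinP; apply: measurable_funM.
  by apply: measurable_funS mf => //; exact: measurable_I01.
exact: measurable_funTS (@measurable_powR R _).
Qed.

Lemma ehardy_ge0 h t : mfunI_nneg h -> (0 <= ehardy h t)%E.
Proof.
move=> [_ h0]; apply: integral_ge0 => s /hardy_itv_sub Is.
by rewrite lee_fin mulr_ge0 ?powR_ge0// h0.
Qed.

Lemma ehardy_ni h s t : mfunI_nneg h -> 0 <= s -> s <= t -> (ehardy h t <= ehardy h s)%E.
Proof.
move=> h_nn s0 st; apply: ge0_subset_integral => //.
- by apply: measurable_integrand; exact: h_nn.1.
- by move=> u /hardy_itv_sub Iu; rewrite lee_fin mulr_ge0 ?powR_ge0// h_nn.2.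
- move=> u /=; rewrite !in_itv/= => /andP[tu ->]; rewrite andbT.
  apply: le_lt_trans tu; apply: ge0_ler_powR; rewrite ?nnegrE//; first exact: ltW.
  exact: le_trans st.
Qed.

Lemma abs_hardy_op_le f t : measurable_fun I01 f ->
  ((`|hardy_op alpha beta f t|)%:E <= ehardy (absf f) t)%E.
Proof.
move=> mf; rewrite hardy_opE.
apply: (@le_trans _ _ `|ehardy f t|%E).
  by case: (ehardy f t) => //= *; rewrite ?normr0 leey.
apply: le_trans (le_abse_integral _ _ _) _ => //; first exact: measurable_integrand.
rewrite le_eqVlt; apply/orP; left; apply/eqP; apply: eq_integral => s _.
by rewrite /= normrM (ger0_norm (powR_ge0 _ _)).
Qed.

(** A nonincreasing majorant of [g] also majorizes its rearrangement: [g] can exceed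
    the height [E t] only on [(0, t]]. *)
Lemma rearr_le_majorant (g : R -> R) (E : R -> \bar R) t : measurable_fun I01 g ->
  0 < t -> (0 <= E t)%E ->
  (forall x, I01 x -> t < x -> (E x <= E t)%E) ->
  (forall x, I01 x -> (`|g x|%:E <= E x)%E) -> ((rearr g t)%:E <= E t)%E.
Proof.
move=> mg t0; move Ee : (E t) => e; case: e Ee => [e|_ _ _ _|//]; last by rewrite leey.
move=> Ee; rewrite lee_fin => e0 Eni gE; rewrite lee_fin rearr_le//.
apply: (@le_trans _ _ (leb (`]0, t] : set R))).
  apply: le_measure; rewrite ?inE//; first by apply: measurable_superlevel; exact: measurableT_comp.
  move=> x /= [Ix egx]; move: (Ix); rewrite /I01/= !in_itv/= => /andP[-> _] /=.
  rewrite leNgt; apply/negP => tx; move: egx; rewrite ltNge => /negP; apply.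
  by rewrite -lee_fin; apply: le_trans (gE x Ix) _; exact: Eni.
by rewrite lebesgue_measure_itv/= lte_fin t0 oppr0 adde0.
Qed.

(** Tonelli: [s] contributes to [ehardy h x] exactly for [x < s `^ beta^-1]. *)
Lemma integral_ehardy_le h t : mfunI_nneg h -> 0 < t ->
  (\int[leb]_(s in `]0%R, t[) ehardy h s <=
   \int[leb]_(s in I01) (h s * (s `^ (alpha - 1) * Num.min t (s `^ beta^-1)))%:E)%E.
Proof.
move=> h_nn t0; have mh := h_nn.1.
have mk := measurable_kernel mh.
pose B : set (R * R) := fst @^-1` `]0, t[%classic.
pose k z := (kernel h z * (\1_B z)%:E)%E.
have k0 z : (0 <= k z)%E by rewrite mule_ge0 ?kernel_ge0// lee_fin indicE.
have mkk : measurable_fun setT k.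
  apply: emeasurable_funM => //; apply/measurable_EFinP.
  by apply: measurable_indic; rewrite -[X in measurable X]setTI; exact: measurable_fst.
have -> : (\int[leb]_(s in `]0%R, t[) ehardy h s = \int[leb]_x \int[leb]_s k (x, s))%E.
  rewrite integral_mkcond; apply: eq_integral => x _.
  transitivity (\int[leb]_s (kernel h (x, s) * (\1_(`]0%R, t[ : set R) x)%:E))%E.
    rewrite patchE indicE; case: ifPn => xt.
      by under eq_integral do rewrite mule1; rewrite integral_kernel.
    by under eq_integral do rewrite mule0; rewrite integral0.
  by apply: eq_integral => s _; rewrite /k !indicE.
rewrite (@fubini_tonelli _ _ _ _ _ leb leb k)// [leRHS]integral_mkcond.
have mmin : measurable_fun setT (fun s : R => Num.min t (s `^ beta^-1)).
  exact: measurable_minr.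
apply: ge0_le_integral => //.
- by move=> s _; apply: integral_ge0 => x _.
- exact: measurable_fun_fubini_tonelli_G.
- apply/(measurable_restrictT _ _).1 => //; first exact: measurable_I01.
  apply/measurable_EFinP; apply: measurable_funM => //; apply: measurable_funTS.
  by apply: measurable_funM => //; exact: measurable_powR.
move=> s _; rewrite patchE; case: ifPn; rewrite ?inE ?notin_setE => Is; last first.
  rewrite integral0_eq// => x _; rewrite /k /kernel/= patchE memNset//.
  by rewrite !mul0r mul0e.
have s0 : 0 < s by move: Is; rewrite /I01/= in_itv/= => /andP[].
pose A : set R := `]0, Num.min t (s `^ beta^-1)[%classic.
have mA : measurable A by exact: measurable_itv.
have w0 : 0 <= h s * s `^ (alpha - 1) by rewrite mulr_ge0 ?powR_ge0 ?h_nn.2.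
apply: (@le_trans _ _ (\int[leb]_x ((h s * s `^ (alpha - 1))%:E * (\1_A x)%:E))%E).
  apply: ge0_le_integral => //.
  - exact: measurableT_comp mkk (measurable_pair2 _).
  - by apply: emeasurable_funM; [exact: measurable_cst|apply/measurable_EFinP; exact: measurable_indic].
  - move=> x _; rewrite /k /kernel/= patchE mem_set// EFinM -muleA.
    apply: lee_wpmul2l => //; rewrite -EFinM lee_fin !indicE.
    have [xt|] := boolP (_ \in B); last by rewrite mulr0.
    have [xs|] := boolP (_ \in above); last by rewrite mul0r.
    rewrite mem_set ?mulr1//; move: xt xs.
    rewrite !inE /A /B /above/= !in_itv/= lt_min => /andP[x0 ->] xs.
    rewrite x0/=.
    have -> : x = (x `^ beta) `^ beta^-1.
      by rewrite -powRrM mulfV ?gt_eqF// powRr1// ltW.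
    by apply: gt0_ltr_powR; rewrite ?invr_gt0// nnegrE ?powR_ge0// ltW.
rewrite ge0_integralZl_EFin//; last by apply/measurable_EFinP; exact: measurable_indic.
have m0 : 0 < Num.min t (s `^ beta^-1) by rewrite lt_min t0 powR_gt0.
have lebA : leb A = (Num.min t (s `^ beta^-1))%:E.
  by rewrite lebesgue_measure_itv/= lte_fin m0 oppr0 adde0.
rewrite integral_indic// setIT.
by rewrite [X in (_ * X)%E]lebA -EFinM mulrA.
Qed.

Lemma inv2_bracket (u : R) : 0 < u < 1 -> exists n, 2^-1 ^+ n.+1 < u <= 2^-1 ^+ n.
Proof.
move=> /andP[u0 u1].
have ex : exists n, 2^-1 ^+ n.+1 < u.
  exists (Num.truncn u^-1); rewrite exprVn -[ltRHS]invrK ltf_pV2 ?posrE ?invr_gt0 ?exprn_gt0//.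
  apply: (lt_trans (truncnS_gt _)); rewrite -natrX ltr_nat; exact: ltn_expl.
exists (ex_minn ex); case: ex_minnP => -[|n] -> min /=; first by rewrite expr0 ltW.
by rewrite leNgt; apply/negP => /min; rewrite ltnn.
Qed.

(** For [2^-(k+1) <= s < 2^-k] the weight [s `^ (alpha - 1)] is at most the [k]-th
    term of the sum; below [2^-(n+1)] the last term suffices. *)
Lemma kernel_le_dyadic n s : 0 < s < 1 ->
  (Num.max (2^-1 ^+ n.+1) s) `^ (alpha - 1) <=
  \sum_(k < n.+1) (2 `^ (1 - alpha)) ^+ k.+1 * \1_(`]0, 2^-1 ^+ k[ : set R) s.
Proof.
move=> /andP[s0 s1]; have a1 : alpha - 1 <= 0 by rewrite subr_le0 ltW.
have qE m : (2 `^ (1 - alpha)) ^+ m = (2^-1 ^+ m : R) `^ (alpha - 1).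
  by rewrite -[alpha - 1]opprB powR_inv2X.
have q0 m : 0 <= (2 `^ (1 - alpha)) ^+ m :> R by rewrite exprn_ge0// powR_ge0.
have last_term m : s < 2^-1 ^+ m -> (Num.max (2^-1 ^+ m.+1) s) `^ (alpha - 1) <=
    (2 `^ (1 - alpha)) ^+ m.+1 * \1_(`]0, 2^-1 ^+ m[ : set R) s.
  move=> sm; rewrite indicE mem_set ?mulr1; last by rewrite /= in_itv/= s0.
  by rewrite qE; apply: powR_npos_le => //; rewrite ?exprn_gt0// le_max lexx.
elim: n => [|n IHn]; first by rewrite big_ord1; exact: last_term.
rewrite big_ord_recr /=; have [sn|sn] := ltP s (2^-1 ^+ n.+1).
  apply: le_trans (last_term _ sn) _; rewrite lerDr; apply: sumr_ge0 => k _.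
  by rewrite mulr_ge0// indicE.
apply: (@le_trans _ _ (\sum_(k < n.+1) (2 `^ (1 - alpha)) ^+ k.+1 *
    \1_(`]0, 2^-1 ^+ k[ : set R) s)); last first.
  by rewrite lerDl mulr_ge0// indicE.
apply: le_trans IHn; rewrite (max_r sn) max_r//.
by apply: le_trans sn; rewrite [leLHS]exprS ler_piMl// ?exprn_ge0//; lra.
Qed.

(** The only place where [alpha + beta^-1 >= 1] enters: it makes the kernel
    nondecreasing in [s] for [s < t `^ beta], hence bounded there by its value at
    [s = t `^ beta]. *)
Lemma hardy_kernel_le t s : 0 < t -> 0 < s ->
  s `^ (alpha - 1) * Num.min t (s `^ beta^-1) <= t * (Num.max (t `^ beta) s) `^ (alpha - 1).
Proof.
move=> t0 s0; have a1 : alpha - 1 <= 0 by rewrite subr_le0 ltW.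
have tE : t = (t `^ beta) `^ beta^-1.
  by rewrite -powRrM mulfV ?gt_eqF// powRr1// ltW.
have [st|ts] := leP (t `^ beta) s.
  by rewrite mulrC ler_wpM2r ?powR_ge0// ge_min lexx.
apply: (@le_trans _ _ (s `^ (alpha - 1) * s `^ beta^-1)).
  by rewrite ler_wpM2l ?powR_ge0// ge_min lexx orbT.
have pD x : 0 < x -> x `^ beta^-1 * x `^ (alpha - 1) = x `^ (beta^-1 + (alpha - 1)).
  by move=> x0; rewrite -powRD // (gt_eqF x0) implybT.
rewrite {1}tE mulrC !pD ?powR_gt0//; apply: ge0_ler_powR; rewrite ?nnegrE ?powR_ge0 ?(ltW s0) ?(ltW ts)//.
by rewrite addrA subr_ge0 addrC.
Qed.

Lemma integral_ehardy_le_dyadic h t n : mfunI_nneg h -> 0 < t ->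
  2^-1 ^+ n.+1 <= t `^ beta ->
  (\int[leb]_(s in `]0%R, t[) ehardy h s <=
   t%:E * (2 `^ (1 - alpha))%:E * dyadic_sum (2 `^ (1 - alpha)) n h)%E.
Proof.
move=> h_nn t0 nt; apply: le_trans (integral_ehardy_le h_nn t0) _.
have mh := h_nn.1.
set q := 2 `^ (1 - alpha).
have q0 : 0 <= q by exact: powR_ge0.
pose J k : set R := `]0, 2^-1 ^+ k[%classic.
have JI k : J k `<=` I01.
  move=> s; rewrite /J /I01/= !in_itv/= => /andP[-> sk]; rewrite (lt_le_trans sk)//.
  by rewrite exprn_ile1//; lra.
have mJ k : measurable (J k) by exact: measurable_itv.
have mt k : measurable_fun I01 (fun s => (t * q ^+ k.+1)%:E * (h s * \1_(J k) s)%:E)%E.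
  apply: emeasurable_funM; first exact: measurable_cst.
  by apply/measurable_EFinP; apply: measurable_funM => //; exact: measurable_indic.
have t_ge0 k s : I01 s -> (0 <= (t * q ^+ k.+1)%:E * (h s * \1_(J k) s)%:E)%E.
  move=> Is; rewrite -EFinM lee_fin !mulr_ge0 ?exprn_ge0 ?(ltW t0) ?h_nn.2//.
apply: (@le_trans _ _ (\int[leb]_(s in I01)
    (\sum_(k < n.+1) (t * q ^+ k.+1)%:E * (h s * \1_(J k) s)%:E))%E).
  apply: ge0_le_integral.
  - exact: measurable_I01.
  - move=> s Is; rewrite lee_fin !mulr_ge0 ?powR_ge0 ?h_nn.2// le_min ltW//.
    by rewrite powR_ge0.
  - apply/measurable_EFinP; apply: measurable_funM => //; apply: measurable_funTS.
    apply: measurable_funM; first exact: measurable_powR.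
    by apply: measurable_minr => //; exact: measurable_powR.
  - by apply: emeasurable_fun_sum => k; exact: mt.
  move=> s Is; have s01 : 0 < s < 1 by move: Is; rewrite /I01/= in_itv.
  have [s0 s1] := andP s01.
  rewrite -(eq_bigr _ (fun k _ => EFinM _ _)) sumEFin lee_fin.
  apply: (@le_trans _ _ (h s * (t * \sum_(k < n.+1) q ^+ k.+1 * \1_(J k) s))).
    apply: ler_wpM2l; first exact: h_nn.2.
    apply: le_trans (hardy_kernel_le t0 s0) _; rewrite ler_wpM2l ?(ltW t0)//.
    apply: le_trans (kernel_le_dyadic n s01); apply: powR_npos_le.
    + by rewrite lt_max s0 orbT.
    + by rewrite ge_max !le_max nt lexx orbT.
    + by rewrite subr_le0 ltW.
  by rewrite !mulr_sumr; apply: ler_sum => k _; rewrite le_eqVlt; apply/orP; left; apply/eqP; ring.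
rewrite ge0_integral_sum//;
  [|exact: measurable_I01|by move=> k; exact: mt|by move=> k s; exact: t_ge0].
rewrite -EFinM /dyadic_sum ge0_sume_distrr; last first.
  by move=> k _; rewrite mule_ge0// ?lee_fin ?exprn_ge0// head_integral_ge0// exprn_ge0.
apply: lee_sum => k _; rewrite ge0_integralZl_EFin//; first last.
- by rewrite mulr_ge0 ?exprn_ge0// ltW.
- apply/measurable_EFinP; apply: measurable_funM => //.
  by apply: measurable_indic; exact: mJ.
- by move=> s Is; rewrite lee_fin mulr_ge0 ?h_nn.2// indicE.
- exact: measurable_I01.
rewrite muleA -EFinM exprS (mulrA t); apply: lee_wpmul2l.
  by rewrite lee_fin !mulr_ge0 ?exprn_ge0// ltW.
apply: le_trans (integral_le_head_integral h_nn _ (mJ k) (JI k) _); last 2 first.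
- by rewrite exprn_gt0.
- by rewrite lebesgue_measure_itv/= lte_fin exprn_gt0// oppr0 adde0.
rewrite [leRHS]integral_mkcond [leLHS]integral_mkcond.
rewrite le_eqVlt; apply/orP; left; apply/eqP; apply: eq_integral => s _.
rewrite !patchE indicE; case: ifPn => sI; case: ifPn => sJ; rewrite ?mulr1 ?mulr0//.
by move: sI sJ; rewrite inE notin_setE => + /JI.
Qed.

End hardy.

(** * Indicators and lower bounds for Marcinkiewicz norms *)

Section indicators.
Context {R : realType}.
Implicit Types (A B : set R) (t v : R).

Lemma superlevel_indic A l : A `<=` I01 -> 0 < l ->
  [set x | (I01 x /\ l < `|\1_A x : R|)%R] = if l < 1 then A else set0.
Proof.
move=> AI l0; apply/seteqP; split => x /=.
  move=> [Ix]; rewrite indicE; have [xA|xA] := boolP (x \in A).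
    by rewrite normr1 => ->; rewrite inE in xA.
  by rewrite normr0 ltNge (ltW l0).
case: ifPn => // l1 Ax; split; first exact: AI.
by rewrite indicE mem_set// normr1.
Qed.

Lemma rearr_indic A B : A `<=` I01 -> B `<=` I01 -> leb A = leb B ->
  rearr (\1_A) = rearr (\1_B : R -> R).
Proof.
move=> AI BI AB; apply/funext => t; rewrite /rearr; congr inf.
apply/seteqP; split => l /= [l0]; rewrite !superlevel_indic//;
  by case: ifP => // _; rewrite AB.
Qed.

Lemma indic_I01 : \1_(@I01 R) = \1_(`]0, 1[ : set R) :> (R -> R).
Proof. by []. Qed.

(** By rearrangement invariance the norm of an indicator depends on the measure of
    the set only, so it can be compared with that of an initial interval. *)
Lemma fund_fun_indic_le (rho : (R -> R) -> \bar R) A t : ri_norm rho ->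
  measurable A -> A `<=` I01 -> 0 < t <= 1 -> (leb A <= t%:E)%E ->
  (rho (\1_A) <= fund_fun rho t)%E.
Proof.
move=> rn mA AI /andP[t0 t1] At.
have Afin : leb A \is a fin_num.
  by rewrite ge0_fin_numE ?measure_ge0// (le_lt_trans At)// ltry.
pose B : set R := `]0, fine (leb A)[%classic.
have At' : fine (leb A) <= t by rewrite -lee_fin fineK.
have B_sub : B `<=` `]0, t[%classic.
  by move=> x; rewrite /B/= !in_itv/= => /andP[-> /lt_le_trans]; apply.
have BI : B `<=` I01.
  by move=> x /B_sub; rewrite /I01/= !in_itv/= => /andP[-> /lt_le_trans]; apply.
have AB : leb A = leb B.
  rewrite lebesgue_measure_itv/= lte_fin; case: ltP => h.
    by rewrite oppr0 adde0 fineK.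
  rewrite -(fineK Afin); congr (_%:E); apply/le_anti; rewrite h/=.
  by rewrite fine_ge0 ?measure_ge0.
rewrite (ri_rearr rn (mfunI_nneg_indic mA)) (rearr_indic AI BI AB).
rewrite -(ri_rearr rn); last by apply: mfunI_nneg_indic; exact: measurable_itv.
apply: (ri_mono rn); try by apply: mfunI_nneg_indic; exact: measurable_itv.
apply: ae_all => x _; rewrite !indicE ler_nat.
have [xB|//] := boolP (x \in B).
by move: xB; rewrite inE => /B_sub xt; rewrite mem_set.
Qed.

Lemma rearr_ge (g : R -> R) v t x : measurable_fun I01 g -> 0 < x -> x < t -> t <= 1 ->
  (forall y, 0 < y -> y < t -> v <= `|g y|) -> v <= rearr g x.
Proof.
move=> mg x0 xt t1 vg; rewrite leNgt; apply/negP => rv.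
have /lt_eqF : rearr g x < rearr g x; last by rewrite eqxx.
rewrite rearr_gt ?rearr_ge0//; apply: (@lt_le_trans _ _ t%:E); first by rewrite lte_fin.
have t0 : 0 < t by exact: lt_trans xt.
apply: (@le_trans _ _ (leb (`]0, t[ : set R))).
  by rewrite lebesgue_measure_itv/= lte_fin t0 oppr0 adde0.
apply: le_measure; rewrite ?inE//.
  by apply: measurable_superlevel; exact: measurableT_comp.
move=> y; rewrite /I01/= !in_itv/= => /andP[y0 yt]; rewrite y0 (lt_le_trans yt)//.
by split => //; apply: (lt_le_trans rv); exact: vg.
Qed.

Lemma marcinkiewicz_ge (phi g : R -> R) v t : measurable_fun I01 g -> I01 t ->
  0 <= v -> 0 <= phi t ->
  (forall y, 0 < y -> y < t -> v <= `|g y|) ->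
  ((v * phi t)%:E <= marcinkiewicz phi g)%E.
Proof.
move=> mg It v0 p0 vg; have [t0 t1] : 0 < t /\ t < 1.
  by move: It; rewrite /I01/= in_itv/= => /andP[].
apply: (@le_trans _ _ (rearr_avg g t * (phi t)%:E)%E); last first.
  by apply: ereal_sup_ubound; exists t.
rewrite EFinM; apply: lee_wpmul2r; first by rewrite lee_fin.
rewrite /rearr_avg lee_pdivlMl//.
have -> : (t%:E * v%:E = \int[leb]_(s in `]0%R, t[) v%:E)%E.
  rewrite integral_cst//= lebesgue_measure_itv/= lte_fin t0 oppr0 adde0.
  by rewrite muleC.
apply: ge0_le_integral => //.
- apply/measurable_EFinP; apply: measurable_funS (measurable_rearr mg) => //.
    exact: measurable_I01.
  by move=> s; rewrite /I01/= !in_itv/= => /andP[-> st]; exact: lt_trans t1.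
- move=> s /=; rewrite in_itv/= => /andP[s0 st]; rewrite lee_fin.
  by apply: (rearr_ge mg s0 st (ltW t1)).
Qed.

End indicators.

(** * Upper and lower bounds for the fundamental function *)

Section hardy_marcinkiewicz.
Context {R : realType}.
Variables (alpha beta : R).
Hypotheses (alpha_gt0 : 0 < alpha) (alpha_lt1 : alpha < 1) (beta_gt0 : 0 < beta)
  (alpha_beta : 1 <= alpha + beta^-1).
Variable phi : R -> R.
Implicit Types (x y r s t : R) (n : nat) (f : R -> R).
Hypothesis phi_fund : concave_fund_fun phi.

Definition fund_bound (t : R) : \bar R := (t%:E *
       ereal_sup [set (phi (s `^ beta^-1) * s `^ (alpha - 1))%:E
                 | s in `]t, 1%R[])%E.

Let binv_gt0 : 0 < beta^-1. Proof. by rewrite invr_gt0. Qed.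

Let powR_itv x r : 0 < x < 1 -> 0 < r -> 0 < x `^ r < 1.
Proof.
move=> /andP[x0 x1] r0; rewrite powR_gt0//=.
by have := gt0_ltr_powR r0 (ltW x0 : x \in Num.nneg) (ler01 : 1 \in Num.nneg) x1;
  rewrite powR1.
Qed.

Let phi_ge0 x : 0 <= x < 1 -> 0 <= phi x.
Proof. by move=> x01; apply: (cff_ge0 phi_fund); rewrite in_itv. Qed.

Let phi_le x y : 0 <= x -> x <= y -> y < 1 -> phi x <= phi y.
Proof.
move=> x0 xy y1; apply: (cff_ndecr phi_fund); rewrite ?in_itv/= ?x0//.
  exact: le_lt_trans y1.
by rewrite y1 (le_trans x0).
Qed.

Let inv2X_itv n : 0 < (2^-1 ^+ n.+1 : R) < 1.
Proof. by rewrite exprn_gt0//= exprn_ilt1//; lra. Qed.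

(** The exponent [n.+1], rather than [n], keeps the argument of [phi] inside
    [[0, 1[], where alone [phi] is controlled. *)
Definition dyadic_weight n : R := phi ((2^-1 ^+ n.+1) `^ beta^-1).

Let dyadic_weight_itv n : 0 < (2^-1 ^+ n.+1 : R) `^ beta^-1 < 1.
Proof. exact: powR_itv. Qed.

Lemma dyadic_weight_ge0 n : 0 <= dyadic_weight n.
Proof. by have /andP[/ltW x0 x1] := dyadic_weight_itv n; rewrite phi_ge0// x0. Qed.

Lemma dyadic_weight_gt0 n : 0 < dyadic_weight n.
Proof.
have /andP[x0 x1] := dyadic_weight_itv n.
rewrite lt_neqAle dyadic_weight_ge0 andbT eq_sym; apply/eqP.
move/(cff_eq0 phi_fund); rewrite in_itv/= (ltW x0) x1 => /(_ isT) x_eq0.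
by move: x0; rewrite x_eq0 ltxx.
Qed.

(** By concavity, halving [t `^ beta] costs at most the factor [2 `^ beta^-1], which
    compensates for the shift of the exponent in [dyadic_weight]. *)
Lemma phi_le_dyadic_weight n t : 0 < t < 1 -> t `^ beta <= 2^-1 ^+ n ->
  phi t <= 2 `^ beta^-1 * dyadic_weight n.
Proof.
move=> /andP[t0 t1] tn; pose k : R := 2^-1 `^ beta^-1.
have /andP[k0 k1] : 0 < k < 1 by apply: powR_itv => //; lra.
have k2 : 2 `^ beta^-1 * k = 1.
  by rewrite /k -powRM// mulfV// powR1.
have kt : k * t <= (2^-1 ^+ n.+1) `^ beta^-1.
  have -> : k * t = (2^-1 * t `^ beta) `^ beta^-1.
    by rewrite powRM ?powR_ge0// -powRrM mulfV ?gt_eqF// powRr1// ltW.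
  apply: ge0_ler_powR; rewrite ?nnegrE ?(ltW binv_gt0)//.
  - by rewrite mulr_ge0// powR_ge0.
  - by rewrite exprS ler_wpM2l.
rewrite -[phi t]mul1r -[X in X * phi t]k2 -mulrA ler_wpM2l ?powR_ge0//.
apply: le_trans (fund_scale phi_fund _ _) _; rewrite ?(ltW k0) ?(ltW k1) ?(ltW t0)//.
apply: phi_le kt _; first by rewrite mulr_ge0// ltW.
by case/andP : (dyadic_weight_itv n).
Qed.

Lemma fund_bound_ge t s : 0 < t -> t < s -> s < 1 ->
  ((t * (phi (s `^ beta^-1) * s `^ (alpha - 1)))%:E <= fund_bound t)%E.
Proof.
move=> t0 ts s1; rewrite EFinM; apply: lee_wpmul2l; first by rewrite lee_fin ltW.
by apply: ereal_sup_ubound; exists s => //=; rewrite in_itv/= ts.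
Qed.

Let q : R := 2 `^ (1 - alpha).

Let q_gt1 : 1 < q.
Proof.
have a0 : 0 < 1 - alpha by rewrite subr_gt0.
by have := gt0_ltr_powR a0 (ler01 : 1 \in Num.nneg) (ler0n _ 2) (ltr1n R 2);
  rewrite powR1.
Qed.

Let q_ge0 : 0 <= q. Proof. exact: powR_ge0. Qed.

Local Notation rhoZ := (dyadic_norm q dyadic_weight).

Lemma dyadic_norm_finite : (rhoZ (\1_I01) < +oo)%E.
Proof.
have [C C0 HC] := dyadic_min_sum_le_powR alpha_gt0 alpha_lt1.
apply: (@le_lt_trans _ _ (dyadic_weight 0 * C)%:E); last exact: ltry.
apply: ge_ereal_sup => _ [n _ <-].
have := dyadic_sum_indic_le n q_ge0 (@ler01 R); rewrite -indic_I01 => h.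
apply: le_trans (lee_wpmul2l _ h) _; first by rewrite lee_fin dyadic_weight_ge0.
rewrite -EFinM lee_fin ler_pM ?dyadic_weight_ge0//.
- by apply: sumr_ge0 => k _; rewrite mulr_ge0 ?exprn_ge0// le_min exprn_ge0// ler01.
- apply: phi_le; [exact: powR_ge0| |by case/andP: (dyadic_weight_itv 0)].
  apply: ge0_ler_powR; rewrite ?nnegrE ?(ltW binv_gt0) ?exprn_ge0//.
  by rewrite exprS ler_piMr// exprn_ile1//; lra.
- apply: le_trans (HC n 1 _) _; first by rewrite ltr01 ler1n.
  by rewrite powR1 mulr1.
Qed.

Lemma ri_norm_rhoZ : ri_norm rhoZ.
Proof.
apply: ri_norm_dyadic => //; [exact: dyadic_weight_ge0|exact: dyadic_weight_gt0|].
exact: dyadic_norm_finite.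
Qed.

(** For [t < 2^-(n+1)] the [n]-th term is controlled by the supremand at
    [s = 2^-(n+1)]. Otherwise the sum is of order [t `^ alpha], and any [s > t]
    comparable to [t] will do. *)
Lemma dyadic_norm_fund_fun : exists2 K : R, 0 < K &
  forall t, I01 t -> (fund_fun rhoZ t <= K%:E * fund_bound t)%E.
Proof.
have [C C0 HC] := dyadic_min_sum_le_powR alpha_gt0 alpha_lt1.
have q10 : 0 < (q - 1)^-1 by rewrite invr_gt0 subr_gt0.
exists ((q - 1)^-1 + C * q).
  by rewrite addr_gt0// mulr_gt0// (lt_trans ltr01).
move=> t; rewrite /I01/= in_itv/= => /andP[t0 t1].
have K1 : 0 <= C * q by rewrite mulr_ge0// ltW.
apply: ge_ereal_sup => _ [n _ <-].
have h := dyadic_sum_indic_le n q_ge0 (ltW t0).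
apply: le_trans (lee_wpmul2l _ h) _; first by rewrite lee_fin dyadic_weight_ge0.
rewrite -EFinM.
have fb_ge0 s : t < s -> s < 1 -> 0 <= t * (phi (s `^ beta^-1) * s `^ (alpha - 1)).
  move=> ts s1; rewrite !mulr_ge0 ?powR_ge0 ?(ltW t0)// phi_ge0//.
  by have /andP[/ltW -> ->] := powR_itv (introT andP (conj (lt_trans t0 ts) s1)) binv_gt0.
suff [s [ts s1 hs]] : exists s, [/\ t < s, s < 1 &
    dyadic_weight n * dyadic_min_sum q n t <=
    ((q - 1)^-1 + C * q) * (t * (phi (s `^ beta^-1) * s `^ (alpha - 1)))].
  apply: (@le_trans _ _ (((q - 1)^-1 + C * q) *
      (t * (phi (s `^ beta^-1) * s `^ (alpha - 1))))%:E); first by rewrite lee_fin.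
  rewrite EFinM; apply: lee_wpmul2l; last exact: fund_bound_ge.
  by rewrite lee_fin addr_ge0// ltW.
have [ts|st] := ltP t (2^-1 ^+ n.+1).
  have /andP[_ s1] := inv2X_itv n.
  exists (2^-1 ^+ n.+1); split => //; rewrite mulrDl ler_wpDr//.
    by rewrite mulr_ge0// fb_ge0.
  apply: le_trans (ler_wpM2l (dyadic_weight_ge0 n)
    (dyadic_min_sum_le_geometric n q_gt1 (ltW t0))) _.
  rewrite -[alpha - 1]opprB powR_inv2X -/q -/(dyadic_weight n).
  by rewrite le_eqVlt; apply/orP; left; apply/eqP; ring.
(* [s = t * (2 - t)] satisfies [t < s < 1] and [s <= 2 * t] for every [t] in (0, 1) *)
have ts' : t < t * (2 - t) by rewrite ltr_pMr//; lra.
have s1 : t * (2 - t) < 1.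
  rewrite -subr_gt0 (_ : 1 - t * (2 - t) = (1 - t) ^+ 2); last by ring.
  by rewrite exprn_gt0// subr_gt0.
exists (t * (2 - t)); split => //; rewrite mulrDl ler_wpDl//.
  by rewrite mulr_ge0 ?fb_ge0// ltW.
set s := t * (2 - t) in ts' s1 *.
have s0 : 0 < s by exact: lt_trans ts'.
have -> : C * q * (t * (phi (s `^ beta^-1) * s `^ (alpha - 1))) =
  phi (s `^ beta^-1) * (C * (t * (q * s `^ (alpha - 1)))) by ring.
have t_t : t * t `^ (alpha - 1) = t `^ alpha by rewrite mulr_powRB1// ltW.
apply: ler_pM.
- exact: dyadic_weight_ge0.
- by apply: sumr_ge0 => k _; rewrite mulr_ge0 ?exprn_ge0// le_min exprn_ge0// ltW.
- apply: phi_le; [exact: powR_ge0| |].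
    apply: ge0_ler_powR; rewrite ?nnegrE ?(ltW binv_gt0) ?exprn_ge0//.
      exact: ltW.
    by apply: (le_trans st); exact: ltW.
  by case/andP: (powR_itv (introT andP (conj s0 s1)) binv_gt0).
apply: le_trans (HC n t _) _; first by rewrite t0/=; lra.
rewrite ler_wpM2l ?(ltW C0)// -t_t ler_wpM2l ?(ltW t0)//.
have -> : t `^ (alpha - 1) = q * (2 * t) `^ (alpha - 1).
  rewrite powRM ?(ltW t0)// mulrA /q -powRD; last by rewrite pnatr_eq0 implybT.
  by rewrite addrA subrK subrr powRr0 mul1r.
rewrite ler_wpM2l//; apply: powR_npos_le => //.
- by rewrite /s mulrC ler_wpM2r ?(ltW t0)//; lra.
- by rewrite subr_le0 ltW.
Qed.

(** [ehardy (absf f)] is a nonincreasing majorant of the image of [f], so the average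
    of the rearrangement over [(0, t)] is at most that of the majorant, which is a
    dyadic sum by [integral_ehardy_le_dyadic]. *)
Lemma hardy_op_bounded_dyadic :
  bounded_op (hardy_op alpha beta) rhoZ (marcinkiewicz phi).
Proof.
pose C := q * 2 `^ beta^-1.
have C0 : 0 < C by rewrite mulr_gt0 ?powR_gt0// (lt_trans ltr01).
suff H f : ri_space rhoZ f ->
    (ri_norm_of (marcinkiewicz phi) (hardy_op alpha beta f)
     <= C%:E * ri_norm_of rhoZ f)%E.
  exists C => // f Zf; have := H f Zf; case: Zf => mf Zf HZ; split => //.
  split; first exact: measurable_hardy_op.
  apply: (le_lt_trans HZ).
  have afin : ri_norm_of rhoZ f \is a fin_num.
    by rewrite ge0_fin_numE// (ri_ge0 ri_norm_rhoZ)//; exact: mfunI_nneg_abs.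
  by rewrite -(fineK afin) -EFinM ltry.
move=> [mf _]; have h_nn := mfunI_nneg_abs mf.
have mg := measurable_hardy_op alpha beta mf.
apply: ge_ereal_sup => _ [t It <-].
have /andP[t0 t1] : 0 < t < 1 by move: It; rewrite /I01/= in_itv.
have tb : 0 < t `^ beta < 1 by apply: powR_itv => //; rewrite t0.
have [n /andP[nt tn]] := inv2_bracket tb.
have avg_le : (rearr_avg (absf (hardy_op alpha beta f)) t <=
    q%:E * dyadic_sum q n (absf f))%E.
  rewrite /rearr_avg lee_pdivrMl// muleA.
  apply: le_trans (integral_ehardy_le_dyadic alpha_lt1 beta_gt0 alpha_beta h_nn t0 (ltW nt)).
  have sub : `]0, t[%classic `<=` @I01 R.
    by move=> s; rewrite /I01/= !in_itv/= => /andP[-> /lt_trans]; apply.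
  apply: ge0_le_integral => //.
  - by move=> s _; rewrite lee_fin rearr_ge0.
  - apply/measurable_EFinP; apply: measurable_funS (measurable_rearr _) => //.
      exact: measurable_I01.
    exact: (mfunI_nneg_abs mg).1.
  - apply: measurable_funS (measurable_ehardy _ _ h_nn) => //.
    exact: measurable_I01.
  - move=> s st; have /andP[s0 _] : 0 < s < t by move: st; rewrite /= in_itv.
    have mag := (mfunI_nneg_abs mg).1.
    have E0 : (0 <= ehardy alpha beta (absf f) s)%E by exact: ehardy_ge0.
    apply: (rearr_le_majorant mag s0 E0) => x Ix.
    + by move=> /ltW sx; exact: (ehardy_ni _ _ h_nn (ltW s0) sx).
    + by rewrite normr_id; exact: abs_hardy_op_le.
apply: (@le_trans _ _ (q%:E * dyadic_sum q n (absf f) *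
    (2 `^ beta^-1 * dyadic_weight n)%:E)%E).
  apply: lee_pmul => //.
  - rewrite /rearr_avg mule_ge0// ?lee_fin ?invr_ge0 ?(ltW t0)//.
    by apply: integral_ge0 => s _; rewrite lee_fin rearr_ge0.
  - by rewrite lee_fin phi_ge0// (ltW t0).
  - by rewrite lee_fin phi_le_dyadic_weight// t0.
rewrite /C !EFinM -!muleA; apply: lee_wpmul2l; first by rewrite lee_fin.
rewrite muleCA; apply: lee_wpmul2l; first by rewrite lee_fin powR_ge0.
by rewrite muleC; exact: dyadic_norm_ge.
Qed.

(** The interval [(s - t / 2, s)] lies above [s / 2 > y `^ beta], so it is entirely
    inside the domain of integration, and there the weight is at least its value at
    [s]. *)
Lemma hardy_op_indic_ge t s y : 0 < t -> t < s -> s < 1 -> 0 < y -> y `^ beta < s / 2 ->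
  t / 2 * s `^ (alpha - 1) <=
  hardy_op alpha beta (\1_(`]s - t / 2, s[ : set R)) y.
Proof.
move=> t0 ts s1 y0 ys; set J : set R := `]s - t / 2, s[%classic.
pose D : set R := `](y `^ beta), 1[%classic.
have s0 : 0 < s by exact: lt_trans ts.
have JD : J `<=` D.
  move=> u; rewrite /J /D/= !in_itv/= => /andP[su us]; apply/andP; split; last exact: lt_trans s1.
  by apply: (lt_trans ys); apply: lt_trans su; lra.
have mJ : measurable J by exact: measurable_itv.
have mD : measurable D by exact: measurable_itv.
have mk (w : R -> R) : measurable_fun setT w ->
    measurable_fun D (fun u => (\1_J u * w u)%:E).
  move=> mw; apply/measurable_EFinP; apply: measurable_funTS.
  by apply: measurable_funM => //; exact: measurable_indic.
have cst_int (k : R) : 0 <= k -> (\int[leb]_(u in D) (\1_J u * k)%:E = (t / 2 * k)%:E)%E.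
  move=> k0; under eq_integral do rewrite EFinM muleC.
  rewrite ge0_integralZl_EFin//; last first.
    by apply/measurable_EFinP; exact: measurable_indic.
  rewrite integral_indic// (setIidl JD).
  have lebJ : leb J = (t / 2)%:E.
    rewrite lebesgue_measure_itv/= lte_fin ifT; last by rewrite ltrBlDr ltrDl divr_gt0.
    by rewrite -EFinB; congr (_%:E); ring.
  by rewrite [X in (_ * X)%E]lebJ -EFinM mulrC.
have a1 : alpha - 1 <= 0 by rewrite subr_le0 ltW.
have mpow : measurable_fun setT (fun u : R => u `^ (alpha - 1)) by exact: measurable_powR.
have ge : ((t / 2 * s `^ (alpha - 1))%:E <= ehardy alpha beta (\1_J) y)%E.
  rewrite -(cst_int _ (powR_ge0 _ _)); apply: ge0_le_integral.
  - exact: mD.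
  - by move=> u _; rewrite lee_fin mulr_ge0 ?powR_ge0// indicE.
  - by apply: mk; exact: measurable_cst.
  - exact: mk.
  - move=> u _; rewrite lee_fin indicE; have [uJ|_] := boolP (u \in J); last by rewrite !mul0r.
    rewrite !mul1r; move: uJ; rewrite inE /J/= in_itv/= => /andP[su us].
    apply: powR_npos_le => //; last exact: ltW.
    by apply: lt_trans su; lra.
(* finiteness is needed because [hardy_op] is the real part of the integral, which
   would be 0 if the integral were infinite *)
have le : (ehardy alpha beta (\1_J) y <= (t / 2 * (s / 2) `^ (alpha - 1))%:E)%E.
  rewrite -(cst_int _ (powR_ge0 _ _)); apply: ge0_le_integral.
  - exact: mD.
  - by move=> u _; rewrite lee_fin mulr_ge0 ?powR_ge0// indicE.
  - exact: mk.
  - by apply: mk; exact: measurable_cst.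
  - move=> u _; rewrite lee_fin indicE; have [uJ|_] := boolP (u \in J); last by rewrite !mul0r.
    rewrite !mul1r; move: uJ; rewrite inE /J/= in_itv/= => /andP[su us].
    apply: powR_npos_le => //; first by lra.
    by apply/ltW; apply: lt_trans su; lra.
have fin : ehardy alpha beta (\1_J) y \is a fin_num.
  rewrite ge0_fin_numE ?(le_lt_trans le) ?ltry//.
  exact: ehardy_ge0 (mfunI_nneg_indic mJ).
by rewrite hardy_opE -lee_fin fineK.
Qed.

(** The indicator of [(s - t / 2, s)] has norm at most [fund_fun rhoX t], and its image
    is at least [t / 2 * s `^ (alpha - 1)] on [(0, tau)] with
    [tau = (s / 2) `^ beta^-1]. Since [phi tau] is comparable to
    [phi (s `^ beta^-1)], boundedness gives the estimate for each [s]. *)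
Lemma fund_fun_ge (rhoX : (R -> R) -> \bar R) : ri_norm rhoX ->
  bounded_op (hardy_op alpha beta) rhoX (marcinkiewicz phi) ->
  exists2 K : R, 0 < K &
  forall t, I01 t -> (fund_bound t <= K%:E * fund_fun rhoX t)%E.
Proof.
move=> rX [C C0 HC]; pose k : R := 2^-1 `^ beta^-1.
have /andP[k0 k1] : 0 < k < 1 by apply: powR_itv => //; lra.
exists (2 / k * C); first by rewrite mulr_gt0// divr_gt0.
move=> t; rewrite /I01/= in_itv/= => /andP[t0 t1].
rewrite /fund_bound -ereal_sup_pZl//; apply: ge_ereal_sup => _ [_ [s + <-] <-].
rewrite /= in_itv/= => /andP[ts s1].
have s0 : 0 < s by exact: lt_trans ts.
have sb : 0 < s `^ beta^-1 < 1 by apply: powR_itv => //; rewrite s0.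
pose J : set R := `]s - t / 2, s[%classic.
have mJ : measurable J by exact: measurable_itv.
have JI : J `<=` I01.
  move=> u; rewrite /J /I01/= !in_itv/= => /andP[su us].
  by rewrite (lt_trans us)// andbT; apply: lt_trans su; lra.
have lebJ : (leb J <= t%:E)%E.
  rewrite lebesgue_measure_itv/= lte_fin ifT; last by rewrite ltrBlDr ltrDl divr_gt0.
  by rewrite -EFinB lee_fin; lra.
have J_nn := mfunI_nneg_indic mJ.
have XJ : ri_space rhoX (\1_J).
  split; first exact: J_nn.1.
  rewrite ri_norm_abs//; apply: le_lt_trans (ri_one rX).
  apply: (ri_mono rX) => //; first exact: (mfunI_nneg_indic measurable_I01).
  apply: ae_all => x Ix; rewrite !indicE (mem_set Ix).
  by rewrite lern1 leq_b1.
have [[mH _] HJ] := HC _ XJ.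
rewrite (ri_norm_abs rX J_nn) in HJ.
pose tau := k * s `^ beta^-1.
have tauE : tau = (s / 2) `^ beta^-1.
  by rewrite /tau /k mulrC -powRM// ltW.
have /andP[tau0 tau1] : 0 < tau < 1.
  by rewrite tauE; apply: powR_itv => //; lra.
have Itau : I01 tau by rewrite /I01/= in_itv/= tau0.
pose v := t / 2 * s `^ (alpha - 1).
have v0 : 0 <= v by rewrite mulr_ge0 ?powR_ge0// divr_ge0// ltW.
have phitau : k * phi (s `^ beta^-1) <= phi tau.
  by case/andP: sb => /ltW sb0 sb1; apply: fund_scale => //; rewrite ?(ltW k0) ?(ltW k1) ?sb0.
have Hv : ((v * phi tau)%:E <= C%:E * rhoX (\1_J))%E.
  apply: le_trans HJ; apply: marcinkiewicz_ge => //.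
  - exact: (mfunI_nneg_abs mH).1.
  - by rewrite phi_ge0// (ltW tau0).
  - move=> y y0 ytau; rewrite normr_id; apply: le_trans (ler_norm _).
    apply: hardy_op_indic_ge => //.
    have -> : s / 2 = tau `^ beta.
      by rewrite tauE -powRrM mulVf ?gt_eqF// powRr1// divr_ge0// ltW.
    by apply: gt0_ltr_powR => //; rewrite nnegrE ltW.
have t01 : 0 < t <= 1 by rewrite t0 ltW.
have XF := fund_fun_indic_le rX mJ JI t01 lebJ.
rewrite -EFinM [(2 / k * C)%:E]EFinM -muleA.
apply: (@le_trans _ _ ((2 / k)%:E * (v * phi tau)%:E)%E).
  rewrite -EFinM lee_fin.
  have -> : t * (phi (s `^ beta^-1) * s `^ (alpha - 1)) =
      2 / k * (v * (k * phi (s `^ beta^-1))).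
    by rewrite /v; field; rewrite gt_eqF.
  by rewrite ler_wpM2l ?divr_ge0 ?(ltW k0)// ler_wpM2l.
apply: lee_wpmul2l; first by rewrite lee_fin divr_ge0// ltW.
by apply: (le_trans Hv); apply: lee_wpmul2l => //; rewrite lee_fin ltW.
Qed.

End hardy_marcinkiewicz.

Theorem theoremC (R : realType) (alpha beta : R)
    (alpha_gt0 : 0 < alpha) (alpha_lt1 : alpha < 1)
    (beta_gt0 : 0 < beta) (alpha_beta : 1 <= alpha + beta^-1)
    (phi : R -> R) (phi_fund : concave_fund_fun phi)
    (rhoX : (R -> R) -> \bar R)
    (rhoX_largest :
      largest_ri
        (fun rho => bounded_op (hardy_op alpha beta) rho (marcinkiewicz phi))
        rhoX) :
  equiv_on I01 (fund_fun rhoX)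
    (fun t => t%:E *
       ereal_sup [set (phi (s `^ beta^-1) * s `^ (alpha - 1))%:E
                 | s in `]t, 1%R[])%E.
Proof.
have [rX XM Xmax] := rhoX_largest.
have rZ := ri_norm_rhoZ alpha_gt0 alpha_lt1 beta_gt0 phi_fund.
have ZM := hardy_op_bounded_dyadic alpha_gt0 alpha_lt1 beta_gt0 alpha_beta phi_fund.
have [C C0 XZ] := ri_embedding rZ rX (Xmax _ rZ ZM).
have [K K0 Zup] := dyadic_norm_fund_fun alpha_gt0 alpha_lt1 beta_gt0 phi_fund.
have [c c0 Xlow] := fund_fun_ge alpha_lt1 beta_gt0 phi_fund rX XM.
exists c, (C * K); split; [exact: c0|exact: mulr_gt0|] => t It.
split; last exact: Xlow.
apply: le_trans (XZ _ (mfunI_nneg_indic (measurable_itv _))) _.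
rewrite EFinM -muleA; apply: lee_wpmul2l; first by rewrite lee_fin ltW.
exact: Zup.
Qed.
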